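(* Let $A$ be a $C^*$-algebra and let $\mathcal{B}$ be a normed algebra with involution containing $A$ as a left essential ideal. Then the following conditions are equivalent: (i) The algebra $\mathcal{B}$ is Banach (i.e. complete) with respect to the norm $\|b\|=\sup\{\|ba\|: a\in A,\|a\|\le 1\}$, $b\in\mathcal{B}$. (ii) For any integer $n\ge 2$ the algebra $M_n(\mathcal{B})$ is Banach (i.e. complete) with respect to the norm $\|b\|=\sup\{\|ba\|: a\in M_n(A),\|a\|\le 1\}$, $b\in M_n(\mathcal{B})$.
   Context: $A$ is a subalgebra of $\mathcal{B}$ which is a left ideal (i.e. $\mathcal{B}A\subset A$), with the involution of $\mathcal{B}$ restricting to that of $A$. $A$ is a left essential ideal of $\mathcal{B}$ if there is no non-zero $b\in\mathcal{B}$ with $ba=0$ for all $a\in A$ (equivalently, every non-zero two-sided ideal of $\mathcal{B}$ has non-trivial intersection with $A$). $M_n(\mathcal{B})$ is the algebra of $n\times n$ matrices over $\mathcal{B}$, containing $M_n(A)$, which carries its usual $C^*$-algebra structure. In the suprema, $\|a\|$ and $\|ba\|$ denote the $C^*$-norms in $A$ (respectively $M_n(A)$); note that $ba\in A$ (respectively $ba\in M_n(A)$). *)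

(* Defs.v *)
From HB Require Import structures.
From mathcomp Require Import all_boot all_order all_algebra.
From mathcomp Require Import complex.
From mathcomp Require Import all_classical all_reals all_analysis.

Set Implicit Arguments.
Unset Strict Implicit.
Unset Printing Implicit Defensive.

Import Order.TTheory GRing.Theory Num.Theory.
Import numFieldNormedType.Exports.

Local Open Scope classical_set_scope.
Local Open Scope ring_scope.
Local Open Scope complex_scope.

(* Complex associative algebras with involution.  No unit is required, so the
   product is not the one of the (unital) ring structures of the library. *)
HB.mixin Record Lmodule_isStarAlgebra (R : realType) V
    of GRing.Lmodule R[i] V := {
  smul : V -> V -> V;
  star : V -> V;
  smulA : associative smul;
  smulDl : left_distributive smul +%R;
  smulDr : right_distributive smul +%R;
  smulZl : forall (c : R[i]) x y, smul (c *: x) y = c *: smul x y;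
  smulZr : forall (c : R[i]) x y, smul x (c *: y) = c *: smul x y;
  starK : involutive star;
  starD : {morph star : x y / x + y};
  starM : forall x y, star (smul x y) = smul (star y) (star x);
  starZ : forall (c : R[i]) x, star (c *: x) = c^* *: star x
}.

#[short(type="starAlgType")]
HB.structure Definition StarAlgebra (R : realType) :=
  {V of GRing.Lmodule R[i] V & Lmodule_isStarAlgebra R V}.

Notation "x ** y" := (smul x y) (at level 40, left associativity) : ring_scope.

Section StarAlgebraTheory.
Variables (R : realType) (B : starAlgType R).
Implicit Types x y : B.

Lemma smul_sumr (I : finType) (F : I -> B) x :
  x ** (\sum_i F i) = \sum_i x ** F i.
Proof.
have smul0 : x ** 0 = 0 by apply: (addrI (x ** 0)); rewrite -smulDr !addr0.
by apply: (big_morph (smul x)) => // y z; rewrite smulDr.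
Qed.

Lemma smul_suml (I : finType) (F : I -> B) x :
  (\sum_i F i) ** x = \sum_i F i ** x.
Proof.
have smul0 : 0 ** x = 0 by apply: (addrI (0 ** x)); rewrite -smulDl !addr0.
by apply: (big_morph (fun y => y ** x)) => // y z; rewrite smulDl.
Qed.

Lemma star_sum (I : finType) (F : I -> B) :
  star (\sum_i F i) = \sum_i star (F i).
Proof.
have star0 : star (0 : B) = 0.
  by apply: (addrI (star (0 : B))); rewrite -starD !addr0.
by apply: (big_morph star) => // y z; rewrite starD.
Qed.

End StarAlgebraTheory.

Section MatrixOperations.
Variables (R : realType) (B : starAlgType R).

Definition mxsmul m n p (x : 'M[B]_(m, n)) (y : 'M[B]_(n, p)) : 'M[B]_(m, p) :=
  \matrix_(i, k) \sum_j x i j ** y j k.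

Definition mxstar m n (x : 'M[B]_(m, n)) : 'M[B]_(n, m) :=
  \matrix_(i, j) star (x j i).

Definition mxscale m n (c : R[i]) (x : 'M[B]_(m, n)) : 'M[B]_(m, n) :=
  \matrix_(i, j) (c *: x i j).

End MatrixOperations.

(* An alias, because the library already has scalings and products on 'M[B]_n
   when B is a ring. *)
Definition mxalg (R : realType) (B : starAlgType R) (n : nat) := 'M[B]_n.

Section MatrixAlgebra.
Variables (R : realType) (B : starAlgType R) (n : nat).
Implicit Types x y : 'M[B]_n.

HB.instance Definition _ := GRing.Zmodule.on (mxalg B n).

Fact mxscaleA (a b : R[i]) x : mxscale a (mxscale b x) = mxscale (a * b) x.
Proof. by apply/matrixP => i j; rewrite !mxE scalerA. Qed.

Fact mxscale1 : left_id 1 (@mxscale R B n n).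
Proof. by move=> x; apply/matrixP => i j; rewrite !mxE scale1r. Qed.

Fact mxscaleDr : right_distributive (@mxscale R B n n) +%R.
Proof. by move=> c x y; apply/matrixP => i j; rewrite !mxE scalerDr. Qed.

Fact mxscaleDl x : {morph (@mxscale R B n n)^~ x : a b / a + b}.
Proof. by move=> a b; apply/matrixP => i j; rewrite !mxE scalerDl. Qed.

HB.instance Definition _ := GRing.Zmodule_isLmodule.Build R[i] (mxalg B n)
  mxscaleA mxscale1 mxscaleDr mxscaleDl.

Fact mxsmulA : associative (@mxsmul R B n n n).
Proof.
move=> x y z; apply/matrixP => i l; rewrite !mxE.
under eq_bigr do rewrite mxE smul_sumr.
under [RHS]eq_bigr do rewrite mxE smul_suml.
rewrite exchange_big; apply: eq_bigr => j _; apply: eq_bigr => k _.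
exact: smulA.
Qed.

Fact mxsmulDl : left_distributive (@mxsmul R B n n n) +%R.
Proof.
move=> x y z; apply/matrixP => i k; rewrite !mxE -big_split /=.
by apply: eq_bigr => j _; rewrite mxE smulDl.
Qed.

Fact mxsmulDr : right_distributive (@mxsmul R B n n n) +%R.
Proof.
move=> x y z; apply/matrixP => i k; rewrite !mxE -big_split /=.
by apply: eq_bigr => j _; rewrite mxE smulDr.
Qed.

Fact mxsmulZl (c : R[i]) x y : mxsmul (mxscale c x) y = mxscale c (mxsmul x y).
Proof.
apply/matrixP => i k; rewrite !mxE scaler_sumr.
by apply: eq_bigr => j _; rewrite mxE smulZl.
Qed.

Fact mxsmulZr (c : R[i]) x y : mxsmul x (mxscale c y) = mxscale c (mxsmul x y).
Proof.
apply/matrixP => i k; rewrite !mxE scaler_sumr.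
by apply: eq_bigr => j _; rewrite mxE smulZr.
Qed.

Fact mxstarK : involutive (@mxstar R B n n).
Proof. by move=> x; apply/matrixP => i j; rewrite !mxE starK. Qed.

Fact mxstarD : {morph (@mxstar R B n n) : x y / x + y}.
Proof. by move=> x y; apply/matrixP => i j; rewrite !mxE starD. Qed.

Fact mxstarM x y : mxstar (mxsmul x y) = mxsmul (mxstar y) (mxstar x).
Proof.
apply/matrixP => i k; rewrite !mxE star_sum.
by apply: eq_bigr => j _; rewrite !mxE starM.
Qed.

Fact mxstarZ (c : R[i]) x : mxstar (mxscale c x) = mxscale c^* (mxstar x).
Proof. by apply/matrixP => i j; rewrite !mxE starZ. Qed.

HB.instance Definition _ := Lmodule_isStarAlgebra.Build R (mxalg B n)
  mxsmulA mxsmulDl mxsmulDr mxsmulZl mxsmulZr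
  mxstarK mxstarD mxstarM mxstarZ.

End MatrixAlgebra.

(* Subalgebras are subsets [D] of an ambient algebra.  A norm of a subalgebra is
   a function on the ambient algebra of which only the values on [D] matter; it
   need not be related to any norm of the ambient algebra. *)
Section Norms.
Variables (R : realType) (V : starAlgType R).
Implicit Types (D : set V) (N : V -> R).

Definition star_subalgebra D :=
  [/\ D 0,
      forall x y, D x -> D y -> D (x + y),
      forall (c : R[i]) x, D x -> D (c *: x),
      forall x y, D x -> D y -> D (x ** y)
    & forall x, D x -> D (star x)].

(* `|c| : R[i] is the modulus of c, with zero imaginary part. *)
Definition algebra_norm D N :=
  [/\ forall x, D x -> 0 <= N x,
      forall x, D x -> N x = 0 -> x = 0,
      forall (c : R[i]) x, D x -> N (c *: x) = complex.Re `|c| * N x,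
      forall x y, D x -> D y -> N (x + y) <= N x + N y
    & forall x y, D x -> D y -> N (x ** y) <= N x * N y].

Definition norm_complete D N :=
  forall u : nat -> V, (forall k, D (u k)) ->
    (forall e : R, 0 < e ->
       exists k0, forall k l, (k0 <= k)%N -> (k0 <= l)%N -> N (u k - u l) < e) ->
    exists2 v, D v & (fun k => N (u k - v)) @ \oo --> (0 : R).

Definition banach_algebra D N := algebra_norm D N /\ norm_complete D N.

Definition cstar_algebra D N :=
  [/\ star_subalgebra D,
      banach_algebra D N
    & forall x, D x -> N (star x ** x) = N x ^+ 2].

Definition left_essential_ideal D :=
  [/\ star_subalgebra D,
      forall b a, D a -> D (b ** a)
    & forall b, (forall a, D a -> b ** a = 0) -> b = 0].

(* sup {N (b a) : a \in D, N a <= 1}.  The library's [sup] is 0 on unbounded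
   sets; such a value for b <> 0 is excluded by [algebra_norm]. *)
Definition left_mult_norm D N (b : V) : R :=
  sup [set N (b ** a) | a in [set a | D a /\ N a <= 1]].

End Norms.

Section MatricesOverSubalgebra.
Variables (R : realType) (B : starAlgType R) (A : set B) (nA : B -> R).

Definition mx_over m n : set 'M[B]_(m, n) := [set x | forall i j, A (x i j)].

(* The norm of the Hilbert A-module A^n, whose A-valued inner product is
   <x, y> = \sum_i (x_i)^* y_i; mxsmul (mxstar x) x is the 1 x 1 matrix <x, x>. *)
Definition module_norm n (x : 'cV[B]_n) : R :=
  Num.sqrt (nA (mxsmul (mxstar x) x ord0 ord0)).

(* The C*-norm of M_n(A): the operator norm for the faithful action of M_n(A)
   on A^n by adjointable operators, where mxstar gives the adjoints.  The set is
   bounded for every a in M_n(A), so [sup] is the actual supremum. *)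
Definition mx_cstar_norm n (a : mxalg B n) : R :=
  sup [set module_norm (mxsmul a x)
      | x in [set x | @mx_over n 1 x /\ module_norm x <= 1]].

End MatricesOverSubalgebra.

(* Main.v *)
From HB Require Import structures.
Require Import Defs.
From mathcomp Require Import all_boot all_order all_algebra.
From mathcomp Require Import complex.
From mathcomp Require Import all_classical all_reals all_analysis.
From mathcomp Require Import ring lra.

Set Implicit Arguments.
Unset Strict Implicit.
Unset Printing Implicit Defensive.

Import Order.TTheory GRing.Theory Num.Theory.
Import numFieldNormedType.Exports.

Local Open Scope classical_set_scope.
Local Open Scope ring_scope.
Local Open Scope complex_scope.

(** The two norms are compared entry by entry: for a matrix b over B,
      ||b_ij|| <= ||b|| <= sum_ij ||b_ij||,
    where ||b|| is the left multiplication norm over M_n(A) and the other norms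
    are those over A ([left_mult_norm_entry_le], [left_mult_norm_le_sum]).  Hence
    a sequence of matrices is Cauchy, or convergent, if and only if its entries
    are.  Completeness of B therefore gives completeness of M_n(B), with the limit
    taken entrywise, and completeness of M_2(B) gives that of B, which sits in it
    as a corner.

    The comparison comes from the action of M_n(B) on the Hilbert module A^n.  The
    left inequality tests b on the columns with a single non-zero entry, on which
    the module norm is the norm of A.  The right one uses
    ||x_j|| <= ||x|| <= sum_i ||x_i|| for x in A^n.  These facts, the triangle
    inequality on A^n, and thus the fact that M_n(A) is a normed algebra, all
    follow from the Cauchy-Schwarz inequality
      ||sum_i x_i^* y_i||^2 <= ||sum_i x_i^* x_i|| ||sum_i y_i^* y_i||
    in a C*-algebra ([cstar_cauchy_schwarz]).

    That inequality is the only place where completeness of A enters; it needs the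
    elements x^* x to be positive and the norm to be monotone on positive
    elements.  Both are obtained here without spectra.  In a unital C*-algebra, a
    self-adjoint h with ||1 - h|| <= 1 has a self-adjoint square root, the limit
    of an iteration with rational coefficients ([sqrt_near1]).  If k is
    self-adjoint and ||k|| <= 1, then k + i sqrt(1 - k^2) is unitary, which gives
    ||1 - k^2|| <= 1.  So being a square of a self-adjoint element is a norm
    condition, stable under sums ([psd_add]).  Then x^* x is compared with its
    absolute value ([psd_star_mul]).  An arbitrary C*-algebra embeds isometrically
    in a unital one ([unitization_cstar]).

    The suprema that define the norms must be finite.  For the left
    multiplication norms this is automatic when they are norms: an infinite
    supremum has the value 0, which a norm takes only at b = 0, where the set is
    {0} ([le_left_mult_norm]).  The comparison carries finiteness from entries to
    matrices and back. *)

(** * Moduli of complex numbers and null sequences *)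

Lemma normc_real (R : realType) (r : R) : 0 <= r -> complex.Re `|r%:C| = r.
Proof. by move=> r0; rewrite normc_def /= expr0n addr0 sqrtr_sqr ger0_norm. Qed.

Lemma cvg0_eps (R : realType) (a : nat -> R) : (forall k, 0 <= a k) ->
  a @ \oo --> (0 : R) <->
  (forall e, 0 < e -> exists k0, forall k, (k0 <= k)%N -> a k < e).
Proof.
move=> a0; split=> [h e e0|h].
  have [k0 _ hk] := iffLR (cvgrPdist_lt _ _) h e e0.
  by exists k0 => k /hk /=; rewrite sub0r normrN ger0_norm.
apply/cvgrPdist_lt => e e0; have [k0 hk] := h e e0.
by exists k0 => // k /hk /=; rewrite sub0r normrN ger0_norm.
Qed.

Lemma real_cauchy_lim (R : realType) (a : nat -> R) :
  (forall e, 0 < e -> exists k0, forall k l, (k0 <= k)%N -> (k0 <= l)%N ->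
     `|a k - a l| < e) ->
  exists L, forall e, 0 < e -> exists k0, forall k, (k0 <= k)%N -> `|a k - L| < e.
Proof.
move=> ha.
have /cauchy_cvgP/cvg_ex[L hL] : cauchy (a @ \oo).
  apply/cauchyP => e e0; have [k0 hk] := ha e e0.
  exists (a k0); exists k0 => // k /= kk.
  by rewrite /ball /= distrC; apply: hk.
exists L => e e0; have [k0 _ hk] := iffLR (cvgrPdist_lt _ _) hL e e0.
by exists k0 => k /hk /=; rewrite distrC.
Qed.

Lemma ReD_norm (R : realType) (c d : R[i]) :
  complex.Re `|c + d| <= complex.Re `|c| + complex.Re `|d|.
Proof. by have := ler_normD c d; rewrite lecE /= => /andP[]. Qed.

Lemma ReM_norm (R : realType) (c d : R[i]) :
  complex.Re `|c * d| = complex.Re `|c| * complex.Re `|d|.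
Proof. by rewrite normrM !normc_def /= mul0r subr0. Qed.

Lemma Re_norm_ge0 (R : realType) (c : R[i]) : 0 <= complex.Re `|c|.
Proof. by rewrite normc_def sqrtr_ge0. Qed.

Lemma Re_norm_eq0 (R : realType) (c : R[i]) : complex.Re `|c| = 0 -> c = 0.
Proof.
by move=> h; apply/eqP; rewrite -normr_eq0 normc_def; move: h; rewrite normc_def /= => ->.
Qed.

Lemma Re_norm_conj (R : realType) (c : R[i]) :
  complex.Re `|c^*%C| = complex.Re `|c|.
Proof. by rewrite normcJ. Qed.

Lemma Re_norm_le (R : realType) (c : R[i]) :
  complex.Re `|c| <= `|complex.Re c| + `|complex.Im c|.
Proof.
rewrite normc_def /= -[leRHS]ger0_norm ?addr_ge0 // -sqrtr_sqr ler_wsqrtr //.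
by rewrite sqrrD !real_normK ?num_real // lerD2r lerDl mulrn_wge0 ?mulr_ge0.
Qed.

Lemma abs_Re_le (R : realType) (c : R[i]) :
  `|complex.Re c| <= complex.Re `|c|.
Proof. by rewrite normc_def /= -sqrtr_sqr ler_wsqrtr // lerDl sqr_ge0. Qed.

Lemma abs_Im_le (R : realType) (c : R[i]) :
  `|complex.Im c| <= complex.Re `|c|.
Proof. by rewrite normc_def /= -sqrtr_sqr ler_wsqrtr // lerDr sqr_ge0. Qed.

Lemma complex_cauchy_lim (R : realType) (a : nat -> R[i]) :
  (forall e : R, 0 < e -> exists k0, forall k l, (k0 <= k)%N -> (k0 <= l)%N ->
     complex.Re `|a k - a l| < e) ->
  exists L, forall e : R, 0 < e ->
    exists k0, forall k, (k0 <= k)%N -> complex.Re `|a k - L| < e.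
Proof.
move=> ha.
have [L1 h1] : exists L, forall e, 0 < e ->
    exists k0, forall k, (k0 <= k)%N -> `|complex.Re (a k) - L| < e.
  apply: real_cauchy_lim => e e0; have [k0 hk] := ha e e0; exists k0 => k l kk kl.
  by apply: le_lt_trans (hk k l kk kl); rewrite -raddfB; exact: abs_Re_le.
have [L2 h2] : exists L, forall e, 0 < e ->
    exists k0, forall k, (k0 <= k)%N -> `|complex.Im (a k) - L| < e.
  apply: real_cauchy_lim => e e0; have [k0 hk] := ha e e0; exists k0 => k l kk kl.
  by apply: le_lt_trans (hk k l kk kl); rewrite -raddfB; exact: abs_Im_le.
exists (L1 +i* L2) => e e0.
have e20 : 0 < e / 2 by lra.
have [k1 hk1] := h1 _ e20; have [k2 hk2] := h2 _ e20.
exists (maxn k1 k2) => k; rewrite geq_max => /andP[/hk1 b1 /hk2 b2].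
apply: le_lt_trans (Re_norm_le _) _; rewrite !raddfB.
by rewrite [X in _ < X](splitr e) ltrD.
Qed.

Lemma cvg0_sum (R : realType) (I : finType) (a : I -> nat -> R) :
  (forall i, a i @ \oo --> (0 : R)) ->
  (fun k => \sum_i a i k) @ \oo --> (0 : R).
Proof.
move=> ha.
have := @cvg_big R I +%R 0 xpredT add_continuous nat \oo (index_enum I) a (fun=> 0).
by rewrite big1 //; apply.
Qed.

(** Applying the inequality to [c^-1] and [c *: x] gives its converse. *)
Lemma homogeneous_of_le (R : realType) (V : lmodType R[i]) (D : set V)
    (N : V -> R) :
  (forall c x, D x -> D (c *: x)) -> (forall x, D x -> 0 <= N x) ->
  (forall c x, D x -> N (c *: x) <= complex.Re `|c| * N x) ->
  forall c x, D x -> N (c *: x) = complex.Re `|c| * N x.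
Proof.
move=> DZ N0 NZ c x Dx; apply/le_anti; rewrite NZ // andTb.
have [->|c0] := eqVneq c 0; first by rewrite normr0 mul0r N0 //; exact: DZ.
have := NZ c^-1 (c *: x) (DZ _ _ Dx); rewrite scalerA mulVf // scale1r => h.
apply: le_trans (ler_wpM2l (Re_norm_ge0 c) h) _.
by rewrite mulrA -ReM_norm divff // normr1 mul1r.
Qed.

(** * Square roots in unital C*-algebras *)

(** The C*-identity is required in its weak form, an inequality; the equality
    follows ([uN_sqr]).  Working in a unital ring makes [1 - h] available. *)
Record unital_cstar (R : realType) (E : algType R[i]) (st : E -> E)
    (N : E -> R) : Prop := UnitalCstar {
  ustK : involutive st;
  ustD : {morph st : x y / x + y};
  ustM : forall x y, st (x * y) = st y * st x;
  ustZ : forall (c : R[i]) x, st (c *: x) = c^* *: st x;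
  uN_ge0 : forall x, 0 <= N x;
  uN_eq0 : forall x, N x = 0 -> x = 0;
  uNZ : forall (c : R[i]) x, N (c *: x) = complex.Re `|c| * N x;
  uND : forall x y, N (x + y) <= N x + N y;
  uNM : forall x y, N (x * y) <= N x * N y;
  uNC : forall x, N x ^+ 2 <= N (st x * x);
  uN_complete : forall u : nat -> E,
    (forall e : R, 0 < e ->
       exists k0, forall k l, (k0 <= k)%N -> (k0 <= l)%N -> N (u k - u l) < e) ->
    exists v, forall e : R, 0 < e ->
      exists k0, forall k, (k0 <= k)%N -> N (u k - v) < e }.

Section SqrtIteration.
Variable R : realType.

(** Iterates of the map whose fixed points [s] satisfy [(1 - s)^2 = 1 - a]. *)
Definition sqrt_iter (E : algType R[i]) (a : E) n : E :=
  iter n (fun s => (2^-1)%:C *: (a + s * s)) 0.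

(** The same iteration at the scalar [a = 1].  It increases to a limit, and it
    bounds the iterates at every [a] of norm at most 1, because all coefficients
    are nonnegative. *)
Definition sqrt_bound n : R := iter n (fun s => 2^-1 * (1 + s * s)) 0.

Lemma sqrt_boundS n : sqrt_bound n.+1 = 2^-1 * (1 + sqrt_bound n * sqrt_bound n).
Proof. by []. Qed.

Lemma sqrt_bound_itv n : 0 <= sqrt_bound n <= 1.
Proof.
elim: n => [|n /andP[h0 h1]]; first by rewrite /= lexx ler01.
by rewrite sqrt_boundS; apply/andP; split; nra.
Qed.

Lemma sqrt_bound_ndecr : nondecreasing_seq sqrt_bound.
Proof.
apply/nondecreasing_seqP => n; rewrite sqrt_boundS.
by have /andP[h0 h1] := sqrt_bound_itv n; nra.
Qed.

Lemma sqrt_bound_cauchy (e : R) : 0 < e ->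
  exists k0, forall k l, (k0 <= k)%N -> (k <= l)%N ->
    sqrt_bound l - sqrt_bound k < e.
Proof.
move=> e0.
have /cvg_ex[L hL] : cvgn sqrt_bound.
  apply: nondecreasing_is_cvgn; first exact: sqrt_bound_ndecr.
  by exists 1 => _ [n _ <-]; have /andP[] := sqrt_bound_itv n.
have e20 : 0 < e / 2 by lra.
have [k0 _ hk] := iffLR (cvgrPdist_lt _ _) hL _ e20.
exists k0 => k l hkk hkl.
have /= h1 := hk k hkk; have /= h2 := hk l (leq_trans hkk hkl).
move: h1 h2; rewrite !ltr_norml => /andP[a1 a2] /andP[b1 b2]; lra.
Qed.

End SqrtIteration.

Section UnitalCstar.
Variables (R : realType) (E : algType R[i]) (st : E -> E) (N : E -> R).
Hypothesis hE : unital_cstar st N.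
Implicit Types (x y h k : E) (r t : R).

Lemma uN0 : N 0 = 0.
Proof. by have := uNZ hE 0 0; rewrite scale0r normr0 /= mul0r. Qed.

Lemma uNZr r x : 0 <= r -> N (r%:C *: x) = r * N x.
Proof. by move=> r0; rewrite (uNZ hE) normc_real. Qed.

Lemma uNN x : N (- x) = N x.
Proof. by rewrite -scaleN1r (uNZ hE) normrN1 mul1r. Qed.

Lemma uNB x y : N (x - y) <= N x + N y.
Proof. by rewrite -(uNN y) (uND hE). Qed.

Lemma uN_distC x y : N (x - y) = N (y - x).
Proof. by rewrite -uNN opprB. Qed.

Lemma ust0 : st 0 = 0.
Proof. by apply: (addrI (st 0)); rewrite -(ustD hE) !addr0. Qed.

Lemma ustN x : st (- x) = - st x.
Proof. by apply: (addrI (st x)); rewrite -(ustD hE) !subrr ust0. Qed.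

Lemma ustB x y : st (x - y) = st x - st y.
Proof. by rewrite (ustD hE) ustN. Qed.

Lemma ust1 : st 1 = 1.
Proof. by rewrite -[LHS]mulr1 -{2}(ustK hE 1) -(ustM hE) mulr1 (ustK hE). Qed.

Lemma conjC_real r : Num.conj (r%:C : R[i]) = r%:C.
Proof. exact: conjc_real. Qed.

Lemma ustZr r x : st (r%:C *: x) = r%:C *: st x.
Proof. by rewrite (ustZ hE) conjC_real. Qed.

Lemma uN_star x : N (st x) = N x.
Proof.
suff le z : N z <= N (st z) by apply/le_anti; rewrite -{2}(ustK hE x) !le.
have [->|nz] := eqVneq (N z) 0; first exact: (uN_ge0 hE).
have z0 : 0 < N z by rewrite lt_neqAle eq_sym nz (uN_ge0 hE).
by rewrite -(ler_pM2r z0) -expr2 (le_trans (uNC hE z)) ?(uNM hE).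
Qed.

Lemma uN_sqr x : N (st x * x) = N x ^+ 2.
Proof.
by apply: le_anti; rewrite (uNC hE) andbT expr2 -{1}(uN_star x) (uNM hE).
Qed.

Lemma uN_sa k : st k = k -> N (k * k) = N k ^+ 2.
Proof. by move=> hk; rewrite -uN_sqr hk. Qed.

Lemma sa_sqr_eq0 k : st k = k -> k * k = 0 -> k = 0.
Proof.
move=> hk k0; apply: (uN_eq0 hE).
by apply/eqP; rewrite -sqrf_eq0 -uN_sa // k0 uN0.
Qed.

Lemma uN1_le : N 1 <= 1.
Proof.
have := uN_sa ust1; rewrite mulr1 => h.
have := uN_ge0 hE 1; nra.
Qed.

Lemma uN_real r : 0 <= r -> N (r%:C *: 1) <= r.
Proof. by move=> r0; rewrite uNZr // ler_piMr // uN1_le. Qed.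

(** The form in which identities are passed to limits. *)
Lemma uN_small_eq0 x (C : R) : (forall e, 0 < e -> N x <= C * e) -> x = 0.
Proof.
move=> hx; apply: (uN_eq0 hE); apply/le_anti; rewrite (uN_ge0 hE) andbT.
apply/ler_addgt0Pr => e e0; rewrite add0r.
have [C0|C0] := leP C 0.
  by apply: le_trans (hx _ e0) _; nra.
apply: le_trans (hx (e / C) (divr_gt0 e0 C0)) _.
by rewrite mulrC divfK ?gt_eqF.
Qed.

Lemma sqrt_iterS a n : sqrt_iter a n.+1 =
  (2^-1)%:C *: (a + sqrt_iter a n * sqrt_iter a n) :> E.
Proof. by []. Qed.

Lemma half_ge0 : 0 <= 2^-1 :> R. Proof. by rewrite invr_ge0. Qed.

Lemma sqrt_iter_bound a n : N a <= 1 -> N (sqrt_iter a n) <= sqrt_bound R n.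
Proof.
move=> a1; elim: n => [|n IH]; first by rewrite uN0.
rewrite sqrt_iterS sqrt_boundS uNZr ?half_ge0 // ler_wpM2l ?half_ge0 //.
apply: le_trans (uND hE _ _) _; rewrite lerD //.
by rewrite (le_trans (uNM hE _ _)) ? ler_pM ?(uN_ge0 hE).
Qed.

Lemma uN_sqrB x y : N (x * x - y * y) <= N (x - y) * (N x + N y).
Proof.
have -> : x * x - y * y = x * (x - y) + (x - y) * y.
  by rewrite mulrBr mulrBl addrA subrK.
apply: le_trans (uND hE _ _) _; rewrite [leRHS]mulrDr [N (x - y) * N x]mulrC.
by rewrite lerD ?(uNM hE).
Qed.

Lemma sqrt_iter_step a n : N a <= 1 ->
  N (sqrt_iter a n.+1 - sqrt_iter a n) <= sqrt_bound R n.+1 - sqrt_bound R n.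
Proof.
move=> a1; elim: n => [|n IH].
  by rewrite subr0 subr0; apply: sqrt_iter_bound.
rewrite sqrt_iterS [in X in _ - X]sqrt_iterS -scalerBr uNZr ?half_ge0 //.
rewrite sqrt_boundS [in X in _ <= _ - X]sqrt_boundS -mulrBr ler_wpM2l ?half_ge0 //.
rewrite opprD addrACA subrr add0r opprD addrACA subrr add0r.
apply: le_trans (uN_sqrB _ _) _.
have -> : sqrt_bound R n.+1 * sqrt_bound R n.+1 - sqrt_bound R n * sqrt_bound R n
  = (sqrt_bound R n.+1 - sqrt_bound R n) * (sqrt_bound R n.+1 + sqrt_bound R n).
  by ring.
rewrite ler_pM ?(uN_ge0 hE) ?addr_ge0 ?(uN_ge0 hE) ?lerD //.
all: exact: sqrt_iter_bound.
Qed.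

Lemma sqrt_iter_dist a (k l : nat) : N a <= 1 -> (k <= l)%N ->
  N (sqrt_iter a l - sqrt_iter a k) <= sqrt_bound R l - sqrt_bound R k.
Proof.
move=> a1 /subnK <-; elim: (l - k)%N => [|m IH].
  by rewrite !add0n !subrr uN0.
rewrite addSn -(subrKA (sqrt_iter a (m + k))) -(subrKA (sqrt_bound R (m + k))).
by apply: le_trans (uND hE _ _) _; rewrite lerD // sqrt_iter_step.
Qed.

(** Two consecutive iterates are controlled at once, so that the limit can be
    inserted in the recurrence. *)
Lemma sqrt_iter_lim a : N a <= 1 ->
  exists s, forall e, 0 < e -> exists n,
    N (sqrt_iter a n - s) <= e /\ N (sqrt_iter a n.+1 - s) <= e.
Proof.
move=> a1.
have [e e0|s hs] := uN_complete hE (u := sqrt_iter a).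
  have [k0 hk0] := sqrt_bound_cauchy e0.
  exists k0 => k l hk hl; case: (leqP k l) => kl.
    by rewrite uN_distC; apply: le_lt_trans (sqrt_iter_dist a1 kl) (hk0 _ _ hk kl).
  by apply: le_lt_trans (sqrt_iter_dist a1 (ltnW kl)) (hk0 _ _ hl (ltnW kl)).
exists s => e e0; have [n hn] := hs e e0.
by exists n; split; apply/ltW/hn.
Qed.

Lemma sqrt_iter_sa a n : st a = a -> st (sqrt_iter a n) = sqrt_iter a n.
Proof.
move=> ha; elim: n => [|n IH]; first exact: ust0.
by rewrite sqrt_iterS ustZr (ustD hE) (ustM hE) ha IH.
Qed.

Lemma sqrt_iter_comm a x n : x * a = a * x ->
  x * sqrt_iter a n = sqrt_iter a n * x.
Proof.
move=> ha; elim: n => [|n IH]; first by rewrite mulr0 mul0r.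
rewrite sqrt_iterS -scalerAr -scalerAl mulrDr mulrDl ha; congr (_ *: (_ + _)).
by rewrite mulrA IH -mulrA IH mulrA.
Qed.

(** The root is [1 - s], where [s] is the limit of the iterates for [a = 1 - h].
    Self-adjointness, the bound and commutation hold for every iterate, and thus
    for [s].  The bound on [1 - k] makes the lemma applicable again to [k]. *)
Lemma sqrt_near1 h : st h = h -> N (1 - h) <= 1 ->
  exists k, [/\ st k = k, k * k = h, N (1 - k) <= 1
    & forall x, x * h = h * x -> x * k = k * x].
Proof.
move=> sh h1; set a := 1 - h in h1.
have sa : st a = a by rewrite ustB ust1 sh.
have [s hs] := sqrt_iter_lim h1.
have it1 n : N (sqrt_iter a n) <= 1.
  apply: le_trans (sqrt_iter_bound n h1) _.
  by have /andP[] := sqrt_bound_itv R n.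
have s1 : N s <= 1.
  apply/ler_addgt0Pr => e e0; have [n [hn _]] := hs e e0.
  rewrite -[s](subKr (sqrt_iter a n)); apply: le_trans (uNB _ _) _.
  by rewrite lerD.
have ss : st s = s.
  apply/eqP; rewrite -subr_eq0; apply/eqP/(@uN_small_eq0 _ 2) => e e0.
  have [n [hn _]] := hs e e0.
  rewrite -(subrKA (sqrt_iter a n)); apply: le_trans (uND hE _ _) _.
  rewrite -{1}(sqrt_iter_sa n sa) -ustB uN_star uN_distC.
  by rewrite mulr_natl mulr2n lerD.
have sE : s + s = a + s * s.
  apply/eqP; rewrite -subr_eq0; apply/eqP/(@uN_small_eq0 _ 4) => e e0.
  have [n [hn hn1]] := hs e e0.
  set u := sqrt_iter a n in hn; set v := sqrt_iter a n.+1 in hn1.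
  have vv : v + v = a + u * u.
    rewrite /v sqrt_iterS -scalerDl -rmorphD /=.
    by have -> : 2^-1 + 2^-1 = 1 :> R; [lra | rewrite scale1r].
  have -> : s + s - (a + s * s) = (s - v) + (s - v) + (u * u - s * s).
    by rewrite (addrACA s (- v)) -[- v - v]opprD vv !opprD !addrA subrK.
  have b1 : N (u * u - s * s) <= 2 * e.
    apply: le_trans (uN_sqrB _ _) _; rewrite mulrC.
    apply: ler_pM; rewrite ?addr_ge0 ?(uN_ge0 hE) //.
    by have := it1 n; rewrite -/u; lra.
  have b2 := uND hE (s - v) (s - v).
  have b3 := uND hE (s - v + (s - v)) (u * u - s * s).
  by move: b2 b3; rewrite (uN_distC s v); lra.
exists (1 - s); split.
- by rewrite ustB ust1 ss.
- have aE : a = s + s - s * s by rewrite sE addrK.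
  rewrite -[RHS](subKr 1) -/a aE mulrBr mulr1 mulrBl mul1r.
  by rewrite -[LHS]addrA -opprD [s + (s - _)]addrA.
- by rewrite subKr.
- move=> x xh; have xa : x * a = a * x by rewrite mulrBr mulrBl mulr1 mul1r xh.
  suff xs : x * s = s * x by rewrite mulrBr mulrBl mulr1 mul1r xs.
  apply/eqP; rewrite -subr_eq0; apply/eqP/(@uN_small_eq0 _ (2 * N x)) => e e0.
  have [n [hn _]] := hs e e0; set u := sqrt_iter a n in hn.
  have xu : x * u = u * x by apply: sqrt_iter_comm.
  have -> : x * s - s * x = (u - s) * x - x * (u - s).
    by rewrite mulrBl mulrBr xu opprB [RHS]addrC subrKA.
  have b1 := uNM hE x (u - s); have b2 := uNM hE (u - s) x.
  have b3 := uNB ((u - s) * x) (x * (u - s)).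
  have := uN_ge0 hE x; nra.
Qed.

End UnitalCstar.

(** * Positive elements and the Cauchy-Schwarz inequality *)

Section Positivity.
Variables (R : realType) (E : algType R[i]) (st : E -> E) (N : E -> R).
Hypothesis hE : unital_cstar st N.
Implicit Types (x y h k u v : E) (r t : R).

(** Positivity, as being the square of a self-adjoint element; [psd_near] and
    [psd_dist] translate it into a condition on norms. *)
Definition psd h := exists2 k, st k = k & h = k * k.

Lemma psd_sa h : psd h -> st h = h.
Proof. by case=> k hk ->; rewrite (ustM hE) hk. Qed.

Lemma psd0 : psd 0.
Proof. by exists 0; rewrite ?mulr0 // (ust0 hE). Qed.

Lemma scale_sqr r k : 0 <= r ->
  ((Num.sqrt r)%:C *: k) * ((Num.sqrt r)%:C *: k) = r%:C *: (k * k).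
Proof.
by move=> r0; rewrite -scalerAl -scalerAr scalerA -rmorphM /= -expr2 sqr_sqrtr.
Qed.

Lemma psd_scale r h : 0 <= r -> psd h -> psd (r%:C *: h).
Proof.
move=> r0 [k hk ->]; exists ((Num.sqrt r)%:C *: k); last by rewrite scale_sqr.
by rewrite (ustZr hE) hk.
Qed.

Lemma scale_realK t x : t != 0 -> t%:C *: (t^-1%:C *: x) = x.
Proof. by move=> t0; rewrite scalerA -rmorphM /= divff // scale1r. Qed.

(** [sqrt_near1] for [t^-1 h].  The root is itself positive, as it again
    satisfies the hypothesis of [sqrt_near1] up to scaling. *)
Lemma psd_near h t : st h = h -> 0 < t -> N (t%:C *: 1 - h) <= t ->
  exists k, [/\ st k = k, k * k = h, psd k
    & forall x, x * h = h * x -> x * k = k * x].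
Proof.
move=> sh t0 ht; have t'0 : 0 <= t^-1 by rewrite invr_ge0 ltW.
set h' := t^-1%:C *: h.
have [||k [sk kk k1 kc]] := sqrt_near1 hE (h := h').
- by rewrite (ustZr hE) sh.
- rewrite -(scale_realK 1 (lt0r_neq0 t0)) scalerA mulrC -scalerA -scalerBr.
  by rewrite (uNZr hE) // mulrC ler_pdivrMr // mul1r.
have [k' [sk' kk' _ _]] := sqrt_near1 hE sk k1.
exists ((Num.sqrt t)%:C *: k); split.
- by rewrite (ustZr hE) sk.
- by rewrite scale_sqr ?ltW // kk scale_realK // gt_eqF.
- by apply: psd_scale; rewrite ?sqrtr_ge0 //; exists k'.
- move=> x xh; rewrite -scalerAr -scalerAl kc //.
  by rewrite -scalerAr -scalerAl xh.
Qed.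

Lemma half_double x : 2^-1%:C *: (x + x) = x.
Proof.
rewrite scalerDr -scalerDl -rmorphD /=.
by have -> : 2^-1 + 2^-1 = 1 :> R; [lra | rewrite scale1r].
Qed.

(** [k] is the real part of [u = k + i l], and [u^* u = k^2 + l^2] because [k]
    and [l] commute. *)
Lemma uN_le_sum_sqr k l : st k = k -> st l = l -> k * l = l * k ->
  N k ^+ 2 <= N (k * k + l * l).
Proof.
move=> sk sl kl; set u := k + 'i%R *: l.
have su : st u = k - 'i%R *: l.
  by rewrite (ustD hE) (ustZ hE) sk sl conjCi scaleNr.
have uu : st u * u = k * k + l * l.
  rewrite su mulrDr !mulrBl -!scalerAl -!scalerAr kl scalerA.
  by rewrite -(expr2 ('i%R : R[i])) sqrCi scaleN1r opprK addrA subrK.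
rewrite -uu (uN_sqr hE) ler_pXn2r ?nnegrE ?(uN_ge0 hE) //.
have -> : k = 2^-1%:C *: (u + st u).
  by rewrite su /u addrACA subrr addr0 half_double.
rewrite (uNZr hE) ?half_ge0 //.
by have := uND hE u (st u); rewrite (uN_star hE); lra.
Qed.

(** Scaled to [t = 1]: with [l = sqrt(1 - k^2)], which commutes with [k], the
    identity [l^2 + k^2 = 1] bounds the norm of [l] by that of 1. *)
Lemma psd_dist h t : psd h -> N h <= t -> 0 < t -> N (t%:C *: 1 - h) <= t.
Proof.
move=> [k sk ->]; rewrite (uN_sa hE) // => kt t0.
have t'0 : 0 <= t^-1 by rewrite invr_ge0 ltW.
set k' := (Num.sqrt t^-1)%:C *: k.
have sk' : st k' = k' by rewrite (ustZr hE) sk.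
have kk' : k * k = t%:C *: (k' * k').
  by rewrite scale_sqr // scale_realK // gt_eqF.
have k1 : N (k' * k') <= 1.
  rewrite scale_sqr // (uNZr hE) // (uN_sa hE) //.
  by rewrite mulrC ler_pdivrMr // mul1r.
have [||l [sl ll _ lc]] := sqrt_near1 hE (h := 1 - k' * k').
- by rewrite (ustB hE) (ust1 hE) (ustM hE) sk'.
- by rewrite subKr.
rewrite kk' -scalerBr (uNZr hE) ?(ltW t0) // ler_piMr ?(ltW t0) //.
rewrite -ll (uN_sa hE) //; apply: le_trans (uN_le_sum_sqr sl sk' _) _.
  by rewrite lc // mulrBr mulrBl mulr1 mul1r mulrA.
by rewrite ll subrK (uN1_le hE).
Qed.

(** The sum of two squares is a square, as the condition of [psd_near] adds up. *)
Lemma psd_add u v : psd u -> psd v -> psd (u + v).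
Proof.
move=> pu pv.
have Nu := uN_ge0 hE u; have Nv := uN_ge0 hE v.
have du := psd_dist (t := N u + 1) pu ltac:(lra) ltac:(lra).
have dv := psd_dist (t := N v + 1) pv ltac:(lra) ltac:(lra).
have [|||k [sk kk _ _]] := @psd_near (u + v) ((N u + 1) + (N v + 1)).
- by rewrite (ustD hE) !psd_sa.
- lra.
- rewrite rmorphD /= scalerDl opprD addrACA.
  by apply: le_trans (uND hE _ _) _; rewrite lerD.
by exists k.
Qed.

Lemma psd_sum (I : finType) (F : I -> E) :
  (forall i, psd (F i)) -> psd (\sum_i F i).
Proof.
by move=> hF; apply: (big_ind psd) => //; [exact: psd0 | exact: psd_add].
Qed.

Lemma psd_sqrt h : psd h -> exists k, [/\ st k = k, k * k = h, psd k
    & forall x, x * h = h * x -> x * k = k * x].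
Proof.
move=> ph; have Nh := uN_ge0 hE h.
apply: (@psd_near _ (N h + 1)); [exact: psd_sa | lra |].
by apply: psd_dist => //; lra.
Qed.

Lemma psd_norm_sub v t : st v = v -> N v <= t -> psd (t%:C *: 1 - v).
Proof.
move=> sv vt; have Nv := uN_ge0 hE v.
have [t0|t0] := leP t 0.
  have -> : v = 0 by apply: (uN_eq0 hE); lra.
  have -> : t = 0 by lra.
  by rewrite scale0r subr0; exact: psd0.
have [|||k [sk kk _ _]] := @psd_near (t%:C *: 1 - v) t => //.
- by rewrite (ustB hE) (ustZr hE) (ust1 hE) sv.
- by rewrite subKr.
by exists k.
Qed.

(** Write [h = k^2] and [t - h = l^2].  The roots commute, so that
    [uN_le_sum_sqr] bounds [k]. *)
Lemma psd_norm_le h t : 0 <= t -> psd h -> psd (t%:C *: 1 - h) -> N h <= t.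
Proof.
move=> t0 /psd_sqrt[k [sk kk _ kc]] [l sl ll].
have comm_th x : x * (t%:C *: 1 - h) = (t%:C *: 1 - h) * x -> x * h = h * x.
  rewrite mulrBr mulrBl -scalerAl -scalerAr mulr1 mul1r.
  by move/addrI/oppr_inj.
have kl : k * l = l * k by rewrite kc // comm_th // ll mulrA.
rewrite -kk (uN_sa hE) //; apply: le_trans (uN_le_sum_sqr sk sl kl) _.
by rewrite kk -ll addrC subrK (uN_real hE).
Qed.

(** Everything is compared with the scalar [N v], which dominates [v]. *)
Lemma psd_mono u v : psd u -> psd (v - u) -> N u <= N v.
Proof.
move=> pu pvu; apply: psd_norm_le; rewrite ?(uN_ge0 hE) //.
have pv : psd v by rewrite -(subrK u v); exact: psd_add.
rewrite -(subrKA v); apply: psd_add => //.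
by apply: psd_norm_sub; rewrite ?psd_sa.
Qed.

Lemma psd_opp_eq0 u : psd u -> psd (- u) -> u = 0.
Proof.
move=> pu pNu; apply: (uN_eq0 hE); apply/le_anti; rewrite (uN_ge0 hE) andbT.
by rewrite -(uN0 hE); apply: psd_mono => //; rewrite sub0r.
Qed.

(** With [x = p + i q], [p] and [q] self-adjoint, this is the identity
    [x^* x + x x^* = 2 (p^2 + q^2)]; the proof uses [c = 2 p] and [d = - 2 q]. *)
Lemma psd_star_add x : psd (st x * x + x * st x).
Proof.
set c := x + st x; set d := 'i%R *: (x - st x).
have sc : st c = c by rewrite (ustD hE) (ustK hE) addrC.
have sd : st d = d.
  by rewrite (ustZ hE) (ustB hE) (ustK hE) conjCi scaleNr -scalerN opprB.
have -> : st x * x + x * st x = 2^-1%:C *: (c * c + d * d).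
  rewrite /c /d -scalerAl -scalerAr scalerA -(expr2 ('i%R : R[i])) sqrCi scaleN1r.
  rewrite !(mulrDl, mulrDr, mulrN, mulNr, opprK).
  set xx := x * x; set xs := x * st x; set sx := st x * x; set ss := st x * st x.
  rewrite -[LHS]half_double; congr (_ *: _).
  rewrite !opprD !opprK [xx + xs]addrC [sx + ss]addrC.
  have -> : xs + xx + (ss + sx) = (xx + ss) + (sx + xs).
    by rewrite [xs + xx]addrC addrACA [xs + sx]addrC.
  have -> : - xx + xs + (sx - ss) = - (xx + ss) + (sx + xs).
    by rewrite [sx - _]addrC addrACA -opprD [xs + sx]addrC.
  by rewrite [RHS]addrACA subrr add0r.
apply: psd_scale; first exact: half_ge0.
by apply: psd_add; [exists c | exists d].
Qed.

(** This replaces the comparison of the spectra of [y^* y] and [y y^*].  Let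
    [v = y g] and [w = y y^*].  Then [v^* v = - g^4] and [v v^* = - w^2] are both
    negative, whereas their sum is positive by [psd_star_add].  So [g^4 = 0]. *)
Lemma star_sqr_neg_eq0 y g : st g = g -> st y * y = - (g * g) -> y = 0.
Proof.
move=> sg yy; set w := y * st y.
have sw : st w = w by rewrite (ustM hE) (ustK hE).
have sgg : st (g * g) = g * g by rewrite (ustM hE) sg.
have e1 : st (y * g) * (y * g) = - ((g * g) * (g * g)).
  by rewrite (ustM hE) sg mulrA -(mulrA g) yy mulrN mulNr !mulrA.
have e2 : (y * g) * st (y * g) = - (w * w).
  rewrite (ustM hE) sg mulrA -(mulrA y) -(opprK (g * g)) -yy.
  by rewrite mulrN mulNr /w !mulrA.
have p1 : psd ((g * g) * (g * g)) by exists (g * g).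
have p2 : psd (w * w) by exists w.
have g4 : (g * g) * (g * g) = 0.
  apply: psd_opp_eq0 => //.
  have := psd_add (psd_star_add (y * g)) p2.
  by rewrite e1 e2 subrK.
have g2 := sa_sqr_eq0 hE sgg g4.
apply: (uN_eq0 hE); apply/eqP; rewrite -sqrf_eq0 -(uN_sqr hE) yy g2.
by rewrite oppr0 (uN0 hE).
Qed.

(** Let [h = x^* x], let [k] be its absolute value, the positive root of [h^2],
    and let [q = k - h] be twice the negative part.  As [h q = - k q], the element
    [y = x q] satisfies [y^* y = - k q^2], minus the square of [sqrt(k) q].  So
    [y = 0], whence [h q = 0] and [q^2 = 0], that is [h = k]. *)
Lemma psd_star_mul x : psd (st x * x).
Proof.
set h := st x * x.
have sh : st h = h by rewrite (ustM hE) (ustK hE).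
have [k [sk kk pk kc]] : exists k, [/\ st k = k, k * k = h * h, psd k
    & forall z, z * (h * h) = h * h * z -> z * k = k * z].
  by apply: psd_sqrt; exists h.
have hk : h * k = k * h by rewrite kc // mulrA.
have [m [sm mm _ mc]] := psd_sqrt pk.
set q := k - h.
have sq : st q = q by rewrite (ustB hE) sk sh.
have qh : q * h = h * q by rewrite mulrBr mulrBl hk.
have qk : q * k = k * q by rewrite mulrBr mulrBl hk.
have mq : m * q = q * m by rewrite [RHS]mc // qk.
have hq : h * q = - (k * q).
  by rewrite mulrBr [k * q]mulrBr kk hk opprB.
have smq : st (m * q) = m * q by rewrite (ustM hE) sm sq mq.
have y0 : x * q = 0.
  apply: (star_sqr_neg_eq0 smq).
  rewrite (ustM hE) sq mulrA -(mulrA q) -/h qh hq mulNr; congr (- _).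
  by rewrite {1}mq -[RHS]mulrA (mulrA m) mm mulrA qk.
have hq0 : h * q = 0 by rewrite -mulrA y0 mulr0.
have qq : q * q = 0.
  rewrite {1}/q mulrBl hq0 subr0 -[k * q]opprK -hq hq0 oppr0 //.
have /eqP := sa_sqr_eq0 hE sq qq.
by rewrite subr_eq0 => /eqP <-.
Qed.

(** With [X = sum x_i^* x_i], [Y = sum y_i^* y_i] and [a = sum x_i^* y_i], the
    difference [Y - a^* a] is the sum of the positive elements
    [sum (x_i a - y_i)^* (x_i a - y_i)] and [a^* (1 - X) a]. *)
Lemma cauchy_schwarz_normalized (I : finType) (x y : I -> E) :
  N (\sum_i st (x i) * x i) <= 1 ->
  N (\sum_i st (x i) * y i) ^+ 2 <= N (\sum_i st (y i) * y i).
Proof.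
set X := \sum_i st (x i) * x i; set a := \sum_i st (x i) * y i.
set Y := \sum_i st (y i) * y i => X1.
have sX : st X = X by rewrite psd_sa //; apply: psd_sum => i; exact: psd_star_mul.
have sa : st a = \sum_i st (y i) * x i.
  rewrite (big_morph st (ustD hE) (ust0 hE)); apply: eq_bigr => i _.
  by rewrite (ustM hE) (ustK hE).
have pZ : psd (\sum_i st (x i * a - y i) * (x i * a - y i)).
  by apply: psd_sum => i; exact: psd_star_mul.
have [r sr rr] : psd (1 - X).
  by have := psd_norm_sub sX X1; rewrite scale1r.
have pW : psd (st a * (1 - X) * a).
  by have := psd_star_mul (r * a); rewrite (ustM hE) sr rr !mulrA.
rewrite -(uN_sqr hE); apply: psd_mono; first exact: psd_star_mul.
have -> : Y - st a * a = \sum_i st (x i * a - y i) * (x i * a - y i)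
    + st a * (1 - X) * a; last exact: psd_add.
have -> : \sum_i st (x i * a - y i) * (x i * a - y i) =
    st a * X * a - st a * a - st a * a + Y.
  have e1 : st a * X * a = \sum_i st a * (st (x i) * x i) * a.
    by rewrite -mulr_suml -mulr_sumr.
  have e2 : st a * a = \sum_i st a * (st (x i) * y i) by rewrite -mulr_sumr.
  have e3 : st a * a = \sum_i st (y i) * x i * a by rewrite {1}sa -mulr_suml.
  rewrite e1 {1}e2 e3 -!sumrB -big_split /=; apply: eq_bigr => i _.
  rewrite (ustB hE) (ustM hE) mulrBl !mulrBr !mulrA opprB addrA.
  by rewrite addrAC.
rewrite mulrBr mulr1 mulrBl.
rewrite [_ + Y]addrC -!addrA; congr (_ + _).
by rewrite addrC -!addrA addrC; rewrite !addrA subrK addrK.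
Qed.

(** Scaling [x] by [M^-1/2] for [M >= N X], [M > 0]; letting [M] decrease to [N X]
    covers the case [X = 0]. *)
Lemma cauchy_schwarz (I : finType) (x y : I -> E) :
  N (\sum_i st (x i) * y i) ^+ 2 <=
  N (\sum_i st (x i) * x i) * N (\sum_i st (y i) * y i).
Proof.
set X := \sum_i st (x i) * x i; set a := \sum_i st (x i) * y i.
set Y := \sum_i st (y i) * y i.
have NX := uN_ge0 hE X; have NY := uN_ge0 hE Y.
suff key M : 0 < M -> N X <= M -> N a ^+ 2 <= M * N Y.
  apply/ler_addgt0Pr => e e0.
  have Y1 : 0 < N Y + 1 by lra.
  have e1 : 0 < e / (N Y + 1) by rewrite divr_gt0.
  apply: le_trans (key (N X + e / (N Y + 1)) _ _) _; [lra | lra |].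
  rewrite mulrDl lerD2l mulrAC ler_pdivrMr // ler_pM2l //; lra.
move=> M0 XM; have M'0 : 0 <= M^-1 by rewrite invr_ge0 ltW.
pose c : R := Num.sqrt M^-1; pose x' i := c%:C *: x i.
have X' : \sum_i st (x' i) * x' i = M^-1%:C *: X.
  rewrite scaler_sumr; apply: eq_bigr => i _.
  by rewrite (ustZr hE) -scalerAl -scalerAr scalerA -rmorphM /= -expr2 sqr_sqrtr.
have a' : \sum_i st (x' i) * y i = c%:C *: a.
  by rewrite scaler_sumr; apply: eq_bigr => i _; rewrite (ustZr hE) -scalerAl.
have := @cauchy_schwarz_normalized _ x' y.
rewrite X' a' !(uNZr hE) ?sqrtr_ge0 // exprMn sqr_sqrtr // => /(_ _)-/(_ _).
rewrite ![M^-1 * _]mulrC !ler_pdivrMr // mul1r [N Y * M]mulrC; exact.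
Qed.

End Positivity.

(** * Suprema over unit balls *)

Section UnitSup.
Variables (R : realType) (T : Type) (S : set T) (sc : R -> T -> T).
Variables (f g : T -> R) (x0 : T).
Hypothesis Ssc : forall r x, 0 <= r -> S x -> S (sc r x).
Hypothesis fsc : forall r x, 0 <= r -> S x -> f (sc r x) = r * f x.
Hypothesis gsc : forall r x, 0 <= r -> S x -> g (sc r x) = r * g x.
Hypothesis f_ge0 : forall x, S x -> 0 <= f x.
Hypothesis g_ge0 : forall x, S x -> 0 <= g x.
Hypothesis Sx0 : S x0.

(** The common shape of the operator norm, the C*-norm of matrices and the left
    multiplication norm: the supremum of [g] over the unit ball of [f].  The
    scaling [sc] is a parameter because columns over [B] carry no module
    structure. *)
Definition unit_sup : R := sup [set g x | x in [set x | S x /\ f x <= 1]].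

Let ball_nonempty : [set g x | x in [set x | S x /\ f x <= 1]] !=set0.
Proof.
exists (g (sc 0 x0)), (sc 0 x0) => //; split; first exact: Ssc.
by rewrite fsc // mul0r.
Qed.

Lemma unit_sup_le (M : R) :
  0 <= M -> (forall x, S x -> g x <= M * f x) -> unit_sup <= M.
Proof.
move=> M0 hM; apply: ge_sup => //.
move=> _ [x [Sx fx] <-]; apply: le_trans (hM x Sx) _.
by rewrite ler_piMr.
Qed.

Lemma unit_sup_bounded (C : R) : (forall x, S x -> g x <= C * f x) ->
  has_sup [set g x | x in [set x | S x /\ f x <= 1]].
Proof.
move=> hC; split; first exact: ball_nonempty.
exists `|C| => _ [x [Sx fx] <-]; apply: le_trans (hC x Sx) _.
have := f_ge0 Sx; have := ler_norm C; have := normr_ge0 C; nra.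
Qed.

(** Finiteness of the supremum does not control [g] at the points where [f]
    vanishes, as these cannot be rescaled to norm 1; hence the second hypothesis. *)
Lemma le_unit_sup_of_has_sup :
  has_sup [set g x | x in [set x | S x /\ f x <= 1]] ->
  (forall x, S x -> f x = 0 -> g x = 0) ->
  forall x, S x -> g x <= unit_sup * f x.
Proof.
move=> hs h0 x Sx; have [fx0|fx0] := eqVneq (f x) 0.
  by rewrite h0 // fx0 mulr0.
have fx : 0 < f x by rewrite lt_neqAle eq_sym fx0 f_ge0.
have ifx : 0 <= (f x)^-1 by rewrite invr_ge0 ltW.
rewrite -ler_pdivrMr // mulrC -gsc //.
apply: sup_ubound; first by case: hs.
exists (sc (f x)^-1 x) => //; split; first exact: Ssc.
by rewrite fsc // mulVf.
Qed.

Lemma le_unit_sup (C : R) : (forall x, S x -> g x <= C * f x) ->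
  forall x, S x -> g x <= unit_sup * f x.
Proof.
move=> hC; apply: le_unit_sup_of_has_sup; first exact: unit_sup_bounded hC.
move=> x Sx fx; apply/le_anti; rewrite g_ge0 // andbT.
by have := hC x Sx; rewrite fx mulr0.
Qed.

(** Holds for infinite suprema too, since [sup] is then 0. *)
Lemma unit_sup_ge0 : 0 <= unit_sup.
Proof.
have [hs|hs] := pselect (has_sup [set g x | x in [set x | S x /\ f x <= 1]]).
  have [y hy] := ball_nonempty.
  apply: le_trans (sup_ubound _ hy); last by case: hs.
  by case: hy => x [Sx _] <-; exact: g_ge0.
by rewrite /unit_sup sup_out.
Qed.

End UnitSup.

(** * Involutive algebras and C*-norms *)

Lemma smul0x (R : realType) (V : starAlgType R) (x : V) : 0 ** x = 0.
Proof. by rewrite -(scale0r (0 : V)) smulZl !scale0r. Qed.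

Lemma smulx0 (R : realType) (V : starAlgType R) (x : V) : x ** 0 = 0.
Proof. by rewrite -(scale0r (0 : V)) smulZr !scale0r. Qed.

Section AlgebraNorm.
Variables (R : realType) (V : starAlgType R) (D : set V) (N : V -> R).
Hypothesis D0 : D 0.
Hypothesis hN : algebra_norm D N.

Lemma algebra_norm0 : N 0 = 0.
Proof.
case: hN => _ _ hZ _ _; have := hZ 0 0 D0.
by rewrite scale0r normr0 /= mul0r.
Qed.

Lemma algebra_normZr (r : R) x : 0 <= r -> D x -> N (r%:C *: x) = r * N x.
Proof. by case: hN => _ _ hZ _ _ r0 Dx; rewrite hZ // normc_real. Qed.

Lemma algebra_normN x : D x -> N (- x) = N x.
Proof. by case: hN => _ _ hZ _ _ Dx; rewrite -scaleN1r hZ // normrN1 mul1r. Qed.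

End AlgebraNorm.

(** From [N z ^ 2 = N (star z ** z) <= N (star z) * N z], for [z] and [star z]. *)
Lemma cstar_norm_star (R : realType) (V : starAlgType R) (D : set V) (N : V -> R) x :
  cstar_algebra D N -> D x -> N (star x) = N x.
Proof.
case=> -[_ _ _ _ DS] [[N0 Ndef _ _ NM] _] hC.
suff le z : D z -> N z <= N (star z).
  by move=> Dx; apply/le_anti; rewrite -{2}(starK x) !le ?starK //; exact: DS.
move=> Dz; have [->|nz] := eqVneq (N z) 0; first exact/N0/DS.
have z0 : 0 < N z by rewrite lt_neqAle eq_sym nz N0.
by rewrite -(ler_pM2r z0) -expr2 -hC // NM //; exact: DS.
Qed.

(** The C*-identity turns a bound on right multiplications into a bound on the
    norm: test on [d = star c]. *)
Lemma cstar_norm_le_of_right_mul (R : realType) (V : starAlgType R) (D : set V)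
    (N : V -> R) (c : V) (K : R) :
  cstar_algebra D N -> D c -> 0 <= K ->
  (forall d, D d -> N (c ** d) <= K * N d) -> N c <= K.
Proof.
move=> hA Dc K0 hK; have [[_ _ _ _ DS] [[N0 _ _ _ _] _] hC] := hA.
have [->|nz] := eqVneq (N c) 0; first exact: K0.
have c0 : 0 < N c by rewrite lt_neqAle eq_sym nz N0.
rewrite -(ler_pM2r c0) -[X in X <= _]expr2 -(cstar_norm_star hA Dc) -hC ?starK.
  by apply: hK; exact: DS.
exact: DS.
Qed.

(** * Subalgebras as algebras, and unitizations *)

(** A subalgebra as a type.  The closure properties are an argument because the
    algebra structure depends on them. *)
Definition substar (R : realType) (V : starAlgType R) (D : set V)
  of star_subalgebra D := {x : V | `[< D x >]}.

Section SubStar.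
Variables (R : realType) (V : starAlgType R) (D : set V).
Hypothesis hD : star_subalgebra D.
Local Notation W := (substar hD).
Implicit Types x y z : W.

HB.instance Definition _ := Choice.on W.

Lemma substarP x : D (val x).
Proof. exact/asboolP/(valP x). Qed.

Definition to_substar v (Dv : D v) : W := exist _ v (asboolT Dv).

Let D0 : D 0. Proof. by case: hD. Qed.
Let DD u v : D u -> D v -> D (u + v). Proof. by case: hD => _ h _ _ _; apply: h. Qed.
Let DZ c v : D v -> D (c *: v). Proof. by case: hD => _ _ h _ _; apply: h. Qed.
Let DM u v : D u -> D v -> D (u ** v). Proof. by case: hD => _ _ _ h _; apply: h. Qed.
Let DS v : D v -> D (star v). Proof. by case: hD => _ _ _ _ h; apply: h. Qed.
Let DN v : D v -> D (- v). Proof. by move=> Dv; rewrite -scaleN1r; exact: DZ. Qed.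

Let zero := to_substar D0.
Let opp x := to_substar (DN (substarP x)).
Let add x y := to_substar (DD (substarP x) (substarP y)).
Let scale c x := to_substar (DZ c (substarP x)).
Let mul x y := to_substar (DM (substarP x) (substarP y)).
Let inv x := to_substar (DS (substarP x)).

Fact substar_addrA : associative add.
Proof. by move=> x y z; apply: val_inj; rewrite /= addrA. Qed.
Fact substar_addrC : commutative add.
Proof. by move=> x y; apply: val_inj; rewrite /= addrC. Qed.
Fact substar_add0r : left_id zero add.
Proof. by move=> x; apply: val_inj; rewrite /= add0r. Qed.
Fact substar_addNr : left_inverse zero opp add.
Proof. by move=> x; apply: val_inj; rewrite /= addNr. Qed.
HB.instance Definition _ := GRing.isZmodule.Build W
  substar_addrA substar_addrC substar_add0r substar_addNr.

Fact substar_scalerA a b x : scale a (scale b x) = scale (a * b) x.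
Proof. by apply: val_inj; rewrite /= scalerA. Qed.
Fact substar_scale1r : left_id 1 scale.
Proof. by move=> x; apply: val_inj; rewrite /= scale1r. Qed.
Fact substar_scalerDr : right_distributive scale +%R.
Proof. by move=> c x y; apply: val_inj; rewrite /= scalerDr. Qed.
Fact substar_scalerDl x : {morph scale^~ x : a b / a + b}.
Proof. by move=> a b; apply: val_inj; rewrite /= scalerDl. Qed.
HB.instance Definition _ := GRing.Zmodule_isLmodule.Build R[i] W
  substar_scalerA substar_scale1r substar_scalerDr substar_scalerDl.

Fact substar_mulA : associative mul.
Proof. by move=> x y z; apply: val_inj; rewrite /= smulA. Qed.
Fact substar_mulDl : left_distributive mul +%R.
Proof. by move=> x y z; apply: val_inj; rewrite /= smulDl. Qed.
Fact substar_mulDr : right_distributive mul +%R.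
Proof. by move=> x y z; apply: val_inj; rewrite /= smulDr. Qed.
Fact substar_mulZl (c : R[i]) x y : mul (c *: x) y = c *: mul x y.
Proof. by apply: val_inj; rewrite /= smulZl. Qed.
Fact substar_mulZr (c : R[i]) x y : mul x (c *: y) = c *: mul x y.
Proof. by apply: val_inj; rewrite /= smulZr. Qed.
Fact substar_starK : involutive inv.
Proof. by move=> x; apply: val_inj; rewrite /= starK. Qed.
Fact substar_starD : {morph inv : x y / x + y}.
Proof. by move=> x y; apply: val_inj; rewrite /= starD. Qed.
Fact substar_starM x y : inv (mul x y) = mul (inv y) (inv x).
Proof. by apply: val_inj; rewrite /= starM. Qed.
Fact substar_starZ (c : R[i]) x : inv (c *: x) = c^*%R *: inv x.
Proof. by apply: val_inj; rewrite /= starZ. Qed.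
HB.instance Definition _ := Lmodule_isStarAlgebra.Build R W
  substar_mulA substar_mulDl substar_mulDr substar_mulZl substar_mulZr
  substar_starK substar_starD substar_starM substar_starZ.

Lemma val_substarD x y : val (x + y) = val x + val y. Proof. by []. Qed.
Lemma val_substar_sum (I : finType) (F : I -> W) :
  val (\sum_i F i) = \sum_i val (F i).
Proof. exact: (big_morph val val_substarD erefl). Qed.

End SubStar.

Lemma cstar_substar (R : realType) (V : starAlgType R) (D : set V) (N : V -> R)
    (hA : cstar_algebra D N) (hD : star_subalgebra D) :
  cstar_algebra (V := substar hD) setT (fun x => N (val x)).
Proof.
case: hA => _ [[h1 h2 h3 h4 h5] hc] hC; split; first by split.
  split; first split.
  - by move=> x _; exact: (h1 _ (substarP x)).
  - by move=> x _ /(h2 _ (substarP x)) => h; apply: val_inj.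
  - by move=> c x _; exact: (h3 _ _ (substarP x)).
  - by move=> x y _ _; apply: h4; exact: substarP.
  - by move=> x y _ _; apply: h5; exact: substarP.
  move=> u _ hu; have [v Dv hv] := hc (fun k => val (u k)) (fun k => substarP _) hu.
  by exists (to_substar hD Dv).
by move=> x _; exact: (hC _ (substarP x)).
Qed.

(** Pairs [(t, a)] stand for [t + a].  The unit adjoined is new even when [W] has
    one, so that the same construction serves all algebras. *)
Definition unitization (R : realType) (W : starAlgType R) := (R[i] * W)%type.

Section Unitization.
Variables (R : realType) (W : starAlgType R).
Local Notation E := (unitization W).
Implicit Types (x y z : E) (c : R[i]).

HB.instance Definition _ := GRing.Zmodule.on E.

Let one : E := (1, 0).
Let mul x y : E := (x.1 * y.1, x.1 *: y.2 + y.1 *: x.2 + x.2 ** y.2).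
Let scale c x : E := (c * x.1, c *: x.2).

Fact unitization_mulA : associative mul.
Proof.
move=> [s a] [t b] [r d]; rewrite /mul /= mulrA; congr (_, _).
rewrite !scalerDr !smulDl !smulDr !smulZl !smulZr !scalerA smulA -!addrA.
rewrite [r * s]mulrC [r * t]mulrC; congr (_ + (_ + _)).
rewrite [LHS]addrCA; congr (_ + _); rewrite [RHS]addrCA; congr (_ + _).
exact: addrCA.
Qed.
Fact unitization_mul1 : left_id one mul.
Proof.
by move=> [s a]; rewrite /mul /= mul1r scale1r scaler0 smul0x !addr0.
Qed.
Fact unitization_mulr1 : right_id one mul.
Proof.
by move=> [s a]; rewrite /mul /= mulr1 scale1r scaler0 smulx0 addr0 add0r.
Qed.
Fact unitization_mulDl : left_distributive mul +%R.
Proof.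
move=> [s a] [t b] [r d]; rewrite /mul /=; congr (_, _) => /=.
  by rewrite mulrDl.
by rewrite scalerDl scalerDr smulDl [RHS]addrACA; congr (_ + _); rewrite [RHS]addrACA.
Qed.
Fact unitization_mulDr : right_distributive mul +%R.
Proof.
move=> [s a] [t b] [r d]; rewrite /mul /=; congr (_, _) => /=.
  by rewrite mulrDr.
by rewrite scalerDl scalerDr smulDr [RHS]addrACA; congr (_ + _); rewrite [RHS]addrACA.
Qed.
Fact unitization_1neq0 : one != 0.
Proof. by rewrite xpair_eqE oner_eq0. Qed.
HB.instance Definition _ := GRing.Zmodule_isNzRing.Build E
  unitization_mulA unitization_mul1 unitization_mulr1
  unitization_mulDl unitization_mulDr unitization_1neq0.

Fact unitization_scalerA c d x : scale c (scale d x) = scale (c * d) x.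
Proof. by rewrite /scale /= scalerA mulrA. Qed.
Fact unitization_scale1r : left_id 1 scale.
Proof. by move=> [s a]; rewrite /scale /= mul1r scale1r. Qed.
Fact unitization_scalerDr : right_distributive scale +%R.
Proof. by move=> c x y; congr (_, _); rewrite /= ?mulrDr ?scalerDr. Qed.
Fact unitization_scalerDl x : {morph scale^~ x : a b / a + b}.
Proof. by move=> a b; congr (_, _); rewrite /= ?mulrDl ?scalerDl. Qed.
HB.instance Definition _ := GRing.Zmodule_isLmodule.Build R[i] E
  unitization_scalerA unitization_scale1r unitization_scalerDr unitization_scalerDl.

Fact unitization_scalerAl c x y : c *: (x * y) = (c *: x) * y.
Proof.
congr (_, _) => /=; first by rewrite mulrA.
by rewrite !scalerDr !scalerA smulZl [c * y.1]mulrC.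
Qed.
HB.instance Definition _ := GRing.Lmodule_isLalgebra.Build R[i] E
  unitization_scalerAl.

Fact unitization_scalerAr c x y : c *: (x * y) = x * (c *: y).
Proof.
congr (_, _) => /=; first by rewrite mulrCA.
by rewrite !scalerDr !scalerA smulZr [c * x.1]mulrC.
Qed.
HB.instance Definition _ := GRing.Lalgebra_isAlgebra.Build R[i] E
  unitization_scalerAr.

End Unitization.

(** * The C*-norm of the unitization *)

Section UnitizationNorm.
Variables (R : realType) (W : starAlgType R) (n : W -> R).
Hypothesis hW : cstar_algebra setT n.
Local Notation E := (unitization W).
Implicit Types (z w : E) (c d : W).

(** Left multiplication by [z] on [W], which is an ideal of its unitization. *)
Definition act z c : W := z.1 *: c + z.2 ** c.
Definition ustar z : E := (z.1^*%R, star z.2).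
Definition op_norm z : R := unit_sup setT n (fun c => n (act z c)).

(** The operator norm alone is only a seminorm when [W] has a unit [e], since
    [1 - e] then acts as 0 on [W].  The maximum with the modulus of the scalar part, the
    seminorm of a character, repairs this and keeps the C*-identity. *)
Definition unorm z : R := Num.max (complex.Re `|z.1|) (op_norm z).

Let nN : algebra_norm setT n. Proof. by case: hW => _ []. Qed.
Let n_ge0 c : 0 <= n c. Proof. by case: nN => h _ _ _ _; apply: h. Qed.
Let n_eq0 c : n c = 0 -> c = 0. Proof. by case: nN => _ h _ _ _; apply: h. Qed.
Let nZ (s : R[i]) c : n (s *: c) = complex.Re `|s| * n c.
Proof. by case: nN => _ _ h _ _; apply: h. Qed.
Let nD c d : n (c + d) <= n c + n d.
Proof. by case: nN => _ _ _ h _; apply: h. Qed.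
Let nM c d : n (c ** d) <= n c * n d.
Proof. by case: nN => _ _ _ _ h; apply: h. Qed.
Let nC c : n (star c ** c) = n c ^+ 2. Proof. by case: hW => _ _ h; apply: h. Qed.
Let n_star c : n (star c) = n c. Proof. exact: cstar_norm_star hW _. Qed.
Let nZr (r : R) c : 0 <= r -> n (r%:C *: c) = r * n c.
Proof. by move=> r0; apply: (algebra_normZr nN). Qed.

Lemma actZ z (s : R[i]) c : act z (s *: c) = s *: act z c.
Proof. by rewrite /act smulZr scalerDr !scalerA mulrC. Qed.

Lemma actM z w c : act (z * w) c = act z (act w c).
Proof.
rewrite /act /= !smulDl scalerDr !smulDr !smulZl !smulZr smulA scalerA -!addrA.
congr (_ + _); congr (_ + _).
Qed.

Lemma actD z w c : act (z + w) c = act z c + act w c.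
Proof. by rewrite /act /= scalerDl smulDl addrACA. Qed.

(** [act (ustar z)] is the adjoint of [act z] for the [W]-valued inner product
    [c^* d]. *)
Lemma act_adj z c d : star (act z c) ** d = star c ** act (ustar z) d.
Proof. by rewrite /act starD starZ starM smulDl smulZl smulDr smulZr smulA. Qed.

Let act_bounded z c : setT c ->
  n (act z c) <= (complex.Re `|z.1| + n z.2) * n c.
Proof.
move=> _; apply: le_trans (nD _ _) _.
by rewrite nZ mulrDl lerD2l nM.
Qed.

Let gsc z (r : R) c : 0 <= r -> setT c -> n (act z (r%:C *: c)) = r * n (act z c).
Proof. by move=> r0 _; rewrite actZ nZr. Qed.

Lemma act_le z c : n (act z c) <= op_norm z * n c.
Proof.
by apply: (@le_unit_sup _ _ setT (fun r c => r%:C *: c) n (fun c => n (act z c)) 0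
   _ _ (gsc z) _ _ _ _ (act_bounded z)) => //= *; exact: nZr.
Qed.

Lemma op_norm_le z (M : R) : 0 <= M -> (forall c, n (act z c) <= M * n c) ->
  op_norm z <= M.
Proof.
move=> M0 hM.
by apply: (@unit_sup_le _ _ setT (fun r c => r%:C *: c) n (fun c => n (act z c)) 0)
   => //= *; exact: nZr.
Qed.

Lemma op_norm_ge0 z : 0 <= op_norm z.
Proof.
by apply: (@unit_sup_ge0 _ _ setT (fun r c => r%:C *: c) n (fun c => n (act z c)) 0)
   => //= *; exact: nZr.
Qed.

Lemma op_norm_sqr z : op_norm z ^+ 2 <= op_norm (ustar z * z).
Proof.
rewrite -[leRHS]sqr_sqrtr ?op_norm_ge0 // ler_pXn2r ?nnegrE ?sqrtr_ge0 ?op_norm_ge0 //.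
apply: op_norm_le => [|c]; first exact: sqrtr_ge0.
rewrite -(@ler_pXn2r _ 2) ?nnegrE ?mulr_ge0 ?sqrtr_ge0 // exprMn sqr_sqrtr ?op_norm_ge0 //.
rewrite -nC act_adj -actM; apply: le_trans (nM _ _) _; rewrite n_star.
apply: le_trans (ler_wpM2l (n_ge0 c) (act_le _ _)) _.
by rewrite mulrCA.
Qed.

Lemma op_norm_zero_fst c : n c <= op_norm (0, c).
Proof.
apply: (cstar_norm_le_of_right_mul hW) => // [|d _]; first exact: op_norm_ge0.
by have := act_le (0, c) d; rewrite /act scale0r add0r.
Qed.

(** Cauchy sequences of the unitization have Cauchy components. *)
Lemma op_norm_fst z : n z.2 <= op_norm z + complex.Re `|z.1|.
Proof.
apply: le_trans (op_norm_zero_fst _) _; apply: op_norm_le.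
  by rewrite addr_ge0 ?op_norm_ge0 ?Re_norm_ge0.
move=> c; rewrite /act /= scale0r add0r.
have -> : z.2 ** c = act z c - z.1 *: c by rewrite /act addrAC subrr add0r.
apply: le_trans (nD _ _) _; rewrite (algebra_normN nN) // nZ mulrDl.
by rewrite lerD2r act_le.
Qed.

Lemma unorm_zero_fst c : unorm (0, c) = n c.
Proof.
have -> : unorm (0, c) = Num.max 0 (op_norm (0, c)) by rewrite /unorm normr0.
rewrite max_r ?op_norm_ge0 //.
apply/le_anti; rewrite op_norm_zero_fst andbT; apply: op_norm_le => // d.
by rewrite /act scale0r add0r nM.
Qed.

Lemma unitization_cstar : unital_cstar ustar unorm.
Proof.
split.
- by move=> [s a]; rewrite /ustar /= conjCK starK.
- by move=> [s a] [t b]; rewrite /ustar /= rmorphD starD.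
- move=> [s a] [t b]; congr (_, _) => /=; first by rewrite rmorphM mulrC.
  by rewrite !starD !starZ starM; congr (_ + _); rewrite addrC.
- by move=> c [s a]; congr (_, _) => /=; rewrite ?rmorphM ?starZ.
- by move=> z; rewrite /unorm le_max Re_norm_ge0.
- move=> [s a] /eqP; rewrite eq_le /unorm ge_max => /andP[/andP[/= hs ha] _].
  have s0 : s = 0 by apply: Re_norm_eq0; apply/le_anti; rewrite hs Re_norm_ge0.
  rewrite s0; congr (_, _); apply: n_eq0; apply/le_anti; rewrite n_ge0 andbT.
  by apply: le_trans ha; rewrite s0 op_norm_zero_fst.
- move=> c z; rewrite /unorm maxr_pMr ?Re_norm_ge0 // -ReM_norm; congr Num.max.
  apply: (@homogeneous_of_le _ _ setT) => // [w _|d w _]; first exact: op_norm_ge0.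
  apply: op_norm_le => [|x]; first by rewrite mulr_ge0 ?Re_norm_ge0 ?op_norm_ge0.
  have -> : act (d *: w) x = d *: act w x by rewrite /act scalerDr scalerA smulZl.
  by rewrite nZ -mulrA ler_wpM2l ?Re_norm_ge0 ?act_le.
- move=> z w; rewrite /unorm ge_max; apply/andP; split.
    apply: le_trans (ReD_norm _ _) _.
    by rewrite lerD // le_max lexx.
  apply: op_norm_le => [|c]; first by rewrite addr_ge0 // le_max Re_norm_ge0.
  rewrite actD; apply: le_trans (nD _ _) _; rewrite mulrDl.
  by rewrite lerD //; apply: le_trans (act_le _ _) _;
    rewrite ler_wpM2r // le_max lexx orbT.
- move=> z w; rewrite /unorm ge_max; apply/andP; split.
    by rewrite ReM_norm ler_pM ?Re_norm_ge0 // le_max lexx.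
  apply: op_norm_le => [|c]; first by rewrite mulr_ge0 // le_max Re_norm_ge0.
  rewrite actM; apply: le_trans (act_le _ _) _; rewrite -mulrA.
  apply: ler_pM; rewrite ?op_norm_ge0 ?le_max ?lexx ?orbT //.
  by apply: le_trans (act_le _ _) _; rewrite ler_wpM2r // le_max lexx orbT.
- move=> z; rewrite {1}/unorm.
  have -> : Num.max (complex.Re `|z.1|) (op_norm z) ^+ 2 =
      Num.max (complex.Re `|z.1| ^+ 2) (op_norm z ^+ 2).
    have h1 := Re_norm_ge0 z.1; have h2 := op_norm_ge0 z.
    case: (leP (complex.Re `|z.1|)) => h; [rewrite max_r // | rewrite max_l //].
      by rewrite ler_pXn2r.
    by rewrite ler_pXn2r // ltW.
  have h1 : complex.Re `|(ustar z * z).1| = complex.Re `|z.1| ^+ 2.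
    by rewrite [LHS](ReM_norm (z.1^*%C) z.1) Re_norm_conj.
  by rewrite /unorm ge_max !le_max op_norm_sqr orbT andbT h1 lexx.
- move=> u hu.
  have [t ht] : exists t, forall e : R, 0 < e -> exists k0, forall k, (k0 <= k)%N ->
      complex.Re `|(u k).1 - t| < e.
    apply: complex_cauchy_lim => e e0; have [k0 hk] := hu e e0; exists k0 => k l kk kl.
    by apply: le_lt_trans (hk k l kk kl); rewrite le_max lexx.
  have hc : norm_complete setT n by case: hW => _ [].
  have [||v _ hv] := hc (fun k => (u k).2).
  - by [].
  - move=> e e0; have e20 : 0 < e / 2 by lra.
    have [k0 hk] := hu _ e20; exists k0 => k l kk kl.
    have h1 := hk k l kk kl.
    apply: le_lt_trans (op_norm_fst (u k - u l)) _.
    move: h1; rewrite /unorm gt_max => /andP[h1 h2].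
    by rewrite [X in _ < X](splitr e) ltrD.
  exists (t, v) => e e0; have e20 : 0 < e / 2 by lra.
  have [k1 h1] := ht _ e20; have [k2 h2] := iffLR (cvg0_eps (fun k => n_ge0 ((u k).2 - v))) hv _ e20.
  exists (maxn k1 k2) => k; rewrite geq_max => /andP[/h1 b1 /h2 b2].
  have eE : e = e / 2 + e / 2 by lra.
  rewrite /unorm gt_max; apply/andP; split; first by apply: lt_trans b1 _; lra.
  rewrite eE; apply: le_lt_trans (ltrD b1 b2).
  apply: op_norm_le => [|c]; last exact: act_bounded.
  by rewrite addr_ge0 ?Re_norm_ge0.
Qed.

End UnitizationNorm.

(** The inequality of unital algebras, applied in the unitization of [D]. *)
Lemma cstar_cauchy_schwarz (R : realType) (V : starAlgType R) (D : set V)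
    (N : V -> R) (hA : cstar_algebra D N) (I : finType) (x y : I -> V) :
  (forall i, D (x i)) -> (forall i, D (y i)) ->
  N (\sum_i star (x i) ** y i) ^+ 2 <=
  N (\sum_i star (x i) ** x i) * N (\sum_i star (y i) ** y i).
Proof.
move=> Dx Dy; have hD : star_subalgebra D by case: hA.
have hW := cstar_substar hA hD; have hE := unitization_cstar hW.
pose emb (w : substar hD) : unitization (substar hD) := (0, w).
have embD : {morph emb : a b / a + b} by move=> a b; congr (_, _); rewrite /= addr0.
pose x' i := to_substar hD (Dx i); pose y' i := to_substar hD (Dy i).
have key (f g : I -> substar hD) :
    unorm (fun w : substar hD => N (val w)) (\sum_i ustar (emb (f i)) * emb (g i)) =
    N (\sum_i star (val (f i)) ** val (g i)).
  have -> : \sum_i ustar (emb (f i)) * emb (g i) = emb (\sum_i star (f i) ** g i).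
    rewrite (big_morph emb embD erefl); apply: eq_bigr => i _.
    by congr (_, _); rewrite /= ?mulr0 // conjC0 !scale0r !add0r.
  by rewrite unorm_zero_fst // val_substar_sum.
by have := cauchy_schwarz hE (emb \o x') (emb \o y'); rewrite /= !key.
Qed.

(** * Left multiplication norms *)

Section LeftMultNorm.
Variables (R : realType) (V : starAlgType R) (D : set V) (N : V -> R).
Hypothesis hD : left_essential_ideal D.
Hypothesis hN : algebra_norm D N.
Implicit Types (a b : V).

Let D0 : D 0. Proof. by case: hD => -[]. Qed.
Let DZ (c : R[i]) a : D a -> D (c *: a).
Proof. by case: hD => -[_ _ h _ _] _ _; apply: h. Qed.
Let DM b a : D a -> D (b ** a). Proof. by case: hD => _ h _; apply: h. Qed.
Let N_ge0 a : D a -> 0 <= N a. Proof. by case: hN => h _ _ _ _; apply: h. Qed.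
Let N_eq0 a : D a -> N a = 0 -> a = 0.
Proof. by case: hN => _ h _ _ _; apply: h. Qed.
Let NZr (r : R) a : 0 <= r -> D a -> N (r%:C *: a) = r * N a.
Proof. exact: algebra_normZr hN _ _. Qed.
Let N0 : N 0 = 0. Proof. exact: algebra_norm0 hN. Qed.
Let NbZr b (r : R) a : 0 <= r -> D a -> N (b ** (r%:C *: a)) = r * N (b ** a).
Proof. by move=> r0 Da; rewrite smulZr NZr //; exact: DM. Qed.
Let Nb_ge0 b a : D a -> 0 <= N (b ** a). Proof. by move=> Da; apply/N_ge0/DM. Qed.
Let scD (r : R) a : 0 <= r -> D a -> D (r%:C *: a). Proof. by move=> _; exact: DZ. Qed.

Lemma left_mult_norm_ge0 b : 0 <= left_mult_norm D N b.
Proof.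
by apply: (@unit_sup_ge0 _ _ D (fun r a => r%:C *: a) N (fun a => N (b ** a)) 0)
  => //; exact: Nb_ge0.
Qed.

Lemma left_mult_norm_le b (C : R) : 0 <= C ->
  (forall a, D a -> N (b ** a) <= C * N a) -> left_mult_norm D N b <= C.
Proof.
by apply: (@unit_sup_le _ _ D (fun r a => r%:C *: a) N (fun a => N (b ** a)) 0)
  => //.
Qed.

Lemma le_left_mult_norm_bounded b (C : R) a :
  (forall a, D a -> N (b ** a) <= C * N a) -> D a ->
  N (b ** a) <= left_mult_norm D N b * N a.
Proof.
move=> hC; apply: (@le_unit_sup _ _ D (fun r a => r%:C *: a) N
  (fun a => N (b ** a)) 0 _ _ _ _ _ _ C) => //.
  exact: NbZr.
exact: Nb_ge0.
Qed.

(** Definiteness is essentiality of the ideal; submultiplicativity comes from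
    [(b b') a = b (b' a)] with [b' a] in the ideal. *)
Lemma left_mult_algebra_norm :
  (forall b, exists C : R, forall a, D a -> N (b ** a) <= C * N a) ->
  algebra_norm setT (left_mult_norm D N).
Proof.
move=> bnd; have le b a : D a -> N (b ** a) <= left_mult_norm D N b * N a.
  by have [C hC] := bnd b; exact: le_left_mult_norm_bounded hC.
have [_ _ NZ ND _] := hN; have ge0 := left_mult_norm_ge0.
split.
- by move=> b _; exact: ge0.
- move=> b _ b0; case: hD => _ _; apply => a Da.
  apply: N_eq0; first exact: DM.
  by apply/le_anti; rewrite Nb_ge0 // andbT; have := le b a Da; rewrite b0 mul0r.
- apply: homogeneous_of_le => // c b _.
  apply: left_mult_norm_le => [|a Da]; first by rewrite mulr_ge0 ?Re_norm_ge0.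
  rewrite smulZl NZ -?mulrA; last exact: DM.
  by rewrite ler_wpM2l ?Re_norm_ge0 ?le.
- move=> b b' _ _; apply: left_mult_norm_le => [|a Da]; first by rewrite addr_ge0.
  rewrite smulDl mulrDl; apply: le_trans (ND _ _ (DM _ Da) (DM _ Da)) _.
  by rewrite lerD ?le.
- move=> b b' _ _; apply: left_mult_norm_le => [|a Da]; first by rewrite mulr_ge0.
  rewrite -smulA; apply: le_trans (le _ _ (DM _ Da)) _.
  by rewrite -mulrA ler_wpM2l ?le.
Qed.

(** Left multiplications are bounded as soon as the left multiplication norm is a
    norm: for an unbounded one the supremum is 0, so that [b = 0], a contradiction. *)
Lemma le_left_mult_norm b a : algebra_norm setT (left_mult_norm D N) -> D a ->
  N (b ** a) <= left_mult_norm D N b * N a.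
Proof.
move=> hP Da.
have [hs|hs] := pselect (has_sup [set N (b ** a) | a in [set a | D a /\ N a <= 1]]).
  apply: (@le_unit_sup_of_has_sup _ _ D (fun r a => r%:C *: a) N
    (fun a => N (b ** a))) => //; first exact: NbZr.
  by move=> c Dc /(N_eq0 Dc) ->; rewrite smulx0 N0.
have P0 : left_mult_norm D N b = 0 by rewrite /left_mult_norm sup_out.
have b0 : b = 0 by case: hP => _ h _ _ _; exact: h.
by rewrite P0 b0 smul0x N0 mul0r.
Qed.

End LeftMultNorm.

(** * Matrices over an ideal acting on columns *)

Section MatrixNorms.
Variables (R : realType) (B : starAlgType R) (A : set B) (nA : B -> R).
Hypothesis hA : cstar_algebra A nA.
Hypothesis hAB : left_essential_ideal A.
Implicit Types (a b c d : B).

Let nN : algebra_norm A nA. Proof. by case: hA => _ []. Qed.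
Let n_ge0 c : A c -> 0 <= nA c. Proof. by case: nN => h _ _ _ _; apply: h. Qed.
Let n_eq0 c : A c -> nA c = 0 -> c = 0. Proof. by case: nN => _ h _ _ _; apply: h. Qed.
Let nZ (s : R[i]) c : A c -> nA (s *: c) = complex.Re `|s| * nA c.
Proof. by case: nN => _ _ h _ _; apply: h. Qed.
Let nD c d : A c -> A d -> nA (c + d) <= nA c + nA d.
Proof. by case: nN => _ _ _ h _; apply: h. Qed.
Let nM c d : A c -> A d -> nA (c ** d) <= nA c * nA d.
Proof. by case: nN => _ _ _ _ h; apply: h. Qed.
Let nC c : A c -> nA (star c ** c) = nA c ^+ 2.
Proof. by case: hA => _ _ h; apply: h. Qed.
Let n_star c : A c -> nA (star c) = nA c. Proof. exact: cstar_norm_star. Qed.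
Let A0 : A 0. Proof. by case: hAB => -[]. Qed.
Let AD c d : A c -> A d -> A (c + d).
Proof. by case: hAB => -[_ h _ _ _] _ _; apply: h. Qed.
Let AZ (s : R[i]) c : A c -> A (s *: c).
Proof. by case: hAB => -[_ _ h _ _] _ _; apply: h. Qed.
Let AM b c : A c -> A (b ** c). Proof. by case: hAB => _ h _; apply: h. Qed.
Let AS c : A c -> A (star c).
Proof. by case: hAB => -[_ _ _ _ h] _ _; apply: h. Qed.
Let nA0 : nA 0 = 0. Proof. exact: algebra_norm0 nN. Qed.

Let A_sum (I : finType) (F : I -> B) : (forall i, A (F i)) -> A (\sum_i F i).
Proof. by move=> hF; apply: (big_ind A). Qed.

Lemma norm_sum_le (I : finType) (F : I -> B) : (forall i, A (F i)) ->
  nA (\sum_i F i) <= \sum_i nA (F i).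
Proof.
move=> hF; suff [] : A (\sum_i F i) /\ nA (\sum_i F i) <= \sum_i nA (F i) by [].
apply: (big_ind2 (fun x y => A x /\ nA x <= y)) => [|x x' y y' [Ax hx] [Ay hy]|i _].
- by rewrite nA0.
- by split; [exact: AD | apply: le_trans (nD Ax Ay) _; rewrite lerD].
- by split.
Qed.

Section Columns.
Variable n : nat.
Implicit Types (x y : 'cV[B]_n).
Local Notation over := (@mx_over R B A n 1).
Local Notation mnorm := (@module_norm R B nA n).

Definition inner x y := \sum_i star (x i ord0) ** y i ord0.

Lemma module_normE x : mnorm x = Num.sqrt (nA (inner x x)).
Proof.
rewrite /module_norm mxE; congr (Num.sqrt (nA _)).
by apply: eq_bigr => i _; rewrite mxE.
Qed.

Lemma inner_in x y : over y -> A (inner x y).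
Proof. by move=> hy; apply: A_sum => i; exact/AM/hy. Qed.

Lemma module_norm_ge0 x : 0 <= mnorm x. Proof. exact: sqrtr_ge0. Qed.

Lemma module_norm_sqr x : over x -> mnorm x ^+ 2 = nA (inner x x).
Proof. by move=> hx; rewrite module_normE sqr_sqrtr // n_ge0 //; exact: inner_in. Qed.

Lemma inner_le x y : over x -> over y -> nA (inner x y) <= mnorm x * mnorm y.
Proof.
move=> hx hy.
rewrite -(@ler_pXn2r _ 2) ?nnegrE ?mulr_ge0 ?module_norm_ge0 ?n_ge0 //; last exact: inner_in.
rewrite exprMn !module_norm_sqr //.
exact: (cstar_cauchy_schwarz hA (x := fun i => x i ord0) (y := fun i => y i ord0)).
Qed.

Definition unit_col (j : 'I_n) c : 'cV[B]_n := \col_i (if i == j then c else 0).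

Lemma unit_col_over j c : A c -> over (unit_col j c).
Proof. by move=> Ac i k; rewrite mxE; case: ifP. Qed.

Lemma sum_if_eq (j : 'I_n) (F : 'I_n -> B) :
  \sum_i (if i == j then F i else 0) = F j.
Proof. by rewrite -big_mkcond big_pred1_eq. Qed.

Lemma inner_unit_col x j c : inner x (unit_col j c) = star (x j ord0) ** c.
Proof.
rewrite -(sum_if_eq j (fun i => star (x i ord0) ** c)).
by apply: eq_bigr => i _; rewrite mxE; case: ifP; rewrite ?smulx0.
Qed.

Lemma module_norm_unit_col j c : A c -> mnorm (unit_col j c) = nA c.
Proof.
move=> Ac; rewrite module_normE inner_unit_col mxE eqxx nC //.
by rewrite sqrtr_sqr ger0_norm // n_ge0.
Qed.

(** Cauchy-Schwarz against the column whose only non-zero entry is [x_j]. *)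
Lemma entry_le x j : over x -> nA (x j ord0) <= mnorm x.
Proof.
move=> hx; have Axj := hx j ord0.
have [->|nz] := eqVneq (nA (x j ord0)) 0; first exact: module_norm_ge0.
have c0 : 0 < nA (x j ord0) by rewrite lt_neqAle eq_sym nz n_ge0.
rewrite -(ler_pM2r c0) -expr2 -nC // -inner_unit_col.
apply: le_trans (inner_le hx (unit_col_over j Axj)) _.
by rewrite module_norm_unit_col.
Qed.

Lemma over_add x y : over x -> over y -> over (x + y).
Proof. by move=> hx hy i j; rewrite mxE; exact: AD. Qed.

Lemma module_normD x y : over x -> over y -> mnorm (x + y) <= mnorm x + mnorm y.
Proof.
move=> hx hy.
rewrite -(@ler_pXn2r _ 2) ?nnegrE ?addr_ge0 ?module_norm_ge0 //.
rewrite module_norm_sqr; last exact: over_add.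
have -> : inner (x + y) (x + y) = (inner x x + inner x y) + (inner y x + inner y y).
  rewrite /inner -!big_split /=; apply: eq_bigr => i _.
  by rewrite !mxE starD smulDl !smulDr.
have Axx := inner_in x hx; have Axy := inner_in x hy.
have Ayx := inner_in y hx; have Ayy := inner_in y hy.
have h1 := nD (AD Axx Axy) (AD Ayx Ayy).
have h2 := nD Axx Axy; have h3 := nD Ayx Ayy.
have h4 := inner_le hx hy; have h5 := inner_le hy hx.
rewrite sqrrD mulr2n !module_norm_sqr //; lra.
Qed.

Lemma module_normZ (s : R[i]) x : over x ->
  mnorm (mxscale s x) = complex.Re `|s| * mnorm x.
Proof.
move=> hx; rewrite !module_normE.
have -> : inner (mxscale s x) (mxscale s x) = (s^*%C * s) *: inner x x.
  rewrite scaler_sumr; apply: eq_bigr => i _.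
  by rewrite !mxE starZ smulZl smulZr scalerA.
rewrite nZ; last exact: inner_in.
rewrite ReM_norm Re_norm_conj -expr2 sqrtrM ?sqr_ge0 //.
by rewrite sqrtr_sqr ger0_norm // Re_norm_ge0.
Qed.

(** The square of the right-hand side dominates the sum of the squares. *)
Lemma module_norm_le_sum x : over x -> mnorm x <= \sum_i nA (x i ord0).
Proof.
move=> hx.
have s0 : 0 <= \sum_i nA (x i ord0) by apply: sumr_ge0 => i _; exact/n_ge0/hx.
rewrite -(@ler_pXn2r _ 2) ?nnegrE ?module_norm_ge0 //.
rewrite module_norm_sqr // expr2 mulr_sumr.
apply: le_trans (norm_sum_le _) _ => [i|]; first exact/AM/hx.
apply: ler_sum => i _; rewrite nC // expr2 ler_wpM2r ?n_ge0 //.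
by rewrite (bigD1 i) //= lerDl sumr_ge0 // => k _; exact/n_ge0/hx.
Qed.

Lemma mxsmul_over m p (b : 'M[B]_(m, n)) (a : 'M[B]_(n, p)) :
  @mx_over R B A n p a -> @mx_over R B A m p (mxsmul b a).
Proof. by move=> ha i k; rewrite mxE; apply: A_sum => j; exact: AM. Qed.

Lemma module_norm_mul_le (b : 'M[B]_n) (p : 'I_n -> 'I_n -> R) x :
  (forall i j c, A c -> nA (b i j ** c) <= p i j * nA c) ->
  (forall i j, 0 <= p i j) -> over x ->
  mnorm (mxsmul b x) <= (\sum_i \sum_j p i j) * mnorm x.
Proof.
move=> hb p0 hx; apply: le_trans (module_norm_le_sum (mxsmul_over b hx)) _.
rewrite mulr_suml; apply: ler_sum => i _; rewrite mxE.
apply: le_trans (norm_sum_le _) _ => [j|]; first exact/AM/hx.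
rewrite mulr_suml; apply: ler_sum => j _.
apply: le_trans (hb _ _ _ (hx j ord0)) _.
by rewrite ler_wpM2l // entry_le.
Qed.

End Columns.

Section MatrixAlgebraNorm.
Variable n : nat.
Implicit Types (x y : 'cV[B]_n) (f g : mxalg B n).
Local Notation over := (@mx_over R B A n 1).
Local Notation Mover := (@mx_over R B A n n).
Local Notation mnorm := (@module_norm R B nA n).
Local Notation nu := (@mx_cstar_norm R B A nA n).
Local Notation sc := (fun r : R => @mxscale R B n 1 r%:C).

Lemma mxsmul_colA f g x : mxsmul (f ** g : 'M[B]_n) x = mxsmul f (mxsmul g x).
Proof.
apply/matrixP => i l; rewrite !mxE.
under eq_bigr do rewrite mxE smul_suml.
under [RHS]eq_bigr do rewrite mxE smul_sumr.
rewrite exchange_big; apply: eq_bigr => j _; apply: eq_bigr => k _.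
by rewrite smulA.
Qed.

Lemma mxsmul_colD f g x : mxsmul (f + g : 'M[B]_n) x = mxsmul f x + mxsmul g x.
Proof.
apply/matrixP => i l; rewrite !mxE -big_split /=; apply: eq_bigr => j _.
by rewrite mxE smulDl.
Qed.

Lemma mxsmul_colZ (s : R[i]) f x :
  mxsmul (s *: f : 'M[B]_n) x = mxscale s (mxsmul f x).
Proof.
apply/matrixP => i l; rewrite !mxE scaler_sumr; apply: eq_bigr => j _.
by rewrite mxE smulZl.
Qed.

Lemma mxsmul_scale_col (s : R[i]) f x :
  mxsmul f (mxscale s x) = mxscale s (mxsmul f x).
Proof.
apply/matrixP => i l; rewrite !mxE scaler_sumr; apply: eq_bigr => j _.
by rewrite mxE smulZr.
Qed.

Let over0 : over 0. Proof. by move=> i j; rewrite mxE. Qed.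
Let over_sc (r : R) x : 0 <= r -> over x -> over (sc r x).
Proof. by move=> _ hx i j; rewrite mxE; exact: AZ. Qed.
Let mnorm_sc (r : R) x : 0 <= r -> over x -> mnorm (sc r x) = r * mnorm x.
Proof. by move=> r0 hx; rewrite module_normZ // normc_real. Qed.
Let mnorm_act_sc f (r : R) x : 0 <= r -> over x ->
  mnorm (mxsmul f (sc r x)) = r * mnorm (mxsmul f x).
Proof.
by move=> r0 hx; rewrite mxsmul_scale_col mnorm_sc //; exact: mxsmul_over.
Qed.
Let mnorm_ge0 x : over x -> 0 <= mnorm x.
Proof. by move=> _; exact: module_norm_ge0. Qed.
Let mnorm_act_ge0 f x : over x -> 0 <= mnorm (mxsmul f x).
Proof. by move=> _; exact: module_norm_ge0. Qed.

Lemma mx_cstar_norm_le f (C : R) : 0 <= C ->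
  (forall x, over x -> mnorm (mxsmul f x) <= C * mnorm x) -> nu f <= C.
Proof.
by apply: (@unit_sup_le _ _ over sc mnorm (fun x => mnorm (mxsmul f x)) 0).
Qed.

Lemma mx_cstar_norm_ge0 f : 0 <= nu f.
Proof.
by apply: (@unit_sup_ge0 _ _ over sc mnorm (fun x => mnorm (mxsmul f x)) 0)
  => //; exact: mnorm_act_ge0.
Qed.

Lemma le_mx_cstar_norm f x : Mover f -> over x ->
  mnorm (mxsmul f x) <= nu f * mnorm x.
Proof.
move=> hf; apply: (@le_unit_sup _ _ over sc mnorm (fun x => mnorm (mxsmul f x)) 0
  _ _ _ _ _ _ (\sum_i \sum_j nA (f i j))) => //.
- exact: mnorm_act_sc.
- exact: mnorm_act_ge0.
- move=> y hy; apply: module_norm_mul_le => // i j; last exact/n_ge0/hf.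
  by move=> c Ac; apply: nM.
Qed.

(** The matrix [c E_jj]: it carries [c] into [M_n(A)] without increasing the norm,
    and right multiplication by it isolates column [j]. *)
Definition diag_unit (j : 'I_n) c : mxalg B n :=
  \matrix_(k, l) (if k == j then (if l == j then c else 0) else 0).

Lemma diag_unit_over j c : A c -> Mover (diag_unit j c).
Proof. by move=> Ac k l; rewrite mxE; case: ifP => // _; case: ifP. Qed.

Lemma diag_unit_col j c x :
  mxsmul (diag_unit j c) x = unit_col j (c ** x j ord0).
Proof.
apply/matrixP => k l; rewrite !mxE ord1; case: ifP => kj.
  rewrite -(sum_if_eq j (fun i => c ** x i ord0)); apply: eq_bigr => i _.
  by rewrite mxE kj; case: ifP => // _; rewrite smul0x.
by apply: big1 => i _; rewrite mxE kj smul0x.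
Qed.

Lemma mxsmul_unit_col f j d i : mxsmul f (unit_col j d) i ord0 = f i j ** d.
Proof.
rewrite mxE -(sum_if_eq j (fun k => f i k ** d)); apply: eq_bigr => k _.
by rewrite mxE; case: ifP => // _; rewrite smulx0.
Qed.

Lemma mx_cstar_norm_unit_diag j c : A c -> nu (diag_unit j c) <= nA c.
Proof.
move=> Ac; apply: mx_cstar_norm_le => [|x hx]; first exact: n_ge0.
rewrite diag_unit_col module_norm_unit_col; last exact/AM/hx.
apply: le_trans (nM Ac (hx j ord0)) _.
by rewrite ler_wpM2l ?n_ge0 // entry_le.
Qed.

Lemma mul_unit_diag_entry f j c i : (f ** diag_unit j c) i j = f i j ** c.
Proof.
rewrite [LHS]mxE -(sum_if_eq j (fun k => f i k ** c)); apply: eq_bigr => k _.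
by rewrite mxE eqxx; case: ifP => // _; rewrite smulx0.
Qed.

Lemma mx_star_subalgebra : star_subalgebra (Mover : set (mxalg B n)).
Proof.
split.
- by move=> i j; rewrite mxE.
- by move=> f g hf hg i j; rewrite mxE; exact: AD.
- by move=> s f hf i j; rewrite mxE; exact: AZ.
- by move=> f g hf hg; exact: mxsmul_over.
- by move=> f hf i j; rewrite mxE; exact: AS.
Qed.

Lemma mx_left_essential_ideal : left_essential_ideal (Mover : set (mxalg B n)).
Proof.
split; first exact: mx_star_subalgebra.
  by move=> f g hg; exact: mxsmul_over.
move=> f hf; apply/matrixP => i j; rewrite mxE.
case: hAB => _ _; apply => c Ac.
by rewrite -mul_unit_diag_entry hf ?mxE //; exact: diag_unit_over.
Qed.

Lemma mx_algebra_norm : algebra_norm (Mover : set (mxalg B n)) nu.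
Proof.
have act_over f x : over x -> over (mxsmul f x) by exact: mxsmul_over.
split.
- by move=> f _; exact: mx_cstar_norm_ge0.
- move=> f hf f0; apply/matrixP => i j; rewrite [RHS]mxE.
  apply: n_eq0; first exact: hf.
  apply/le_anti; rewrite n_ge0 ?hf // andbT.
  apply: (cstar_norm_le_of_right_mul hA) => // d Ad.
  rewrite mul0r -mxsmul_unit_col.
  have hd := unit_col_over j Ad.
  apply: le_trans (entry_le _ (act_over f _ hd)) _.
  by apply: le_trans (le_mx_cstar_norm hf hd) _; rewrite f0 mul0r.
- apply: homogeneous_of_le => [|f _|s f hf].
  + by case: mx_star_subalgebra.
  + exact: mx_cstar_norm_ge0.
  + apply: mx_cstar_norm_le => [|x hx].
      by rewrite mulr_ge0 ?Re_norm_ge0 ?mx_cstar_norm_ge0.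
    rewrite mxsmul_colZ module_normZ; last exact: act_over.
    by rewrite -mulrA ler_wpM2l ?Re_norm_ge0 ?le_mx_cstar_norm.
- move=> f g hf hg; apply: mx_cstar_norm_le => [|x hx].
    by rewrite addr_ge0 ?mx_cstar_norm_ge0.
  rewrite mxsmul_colD mulrDl.
  apply: le_trans (module_normD (act_over f _ hx) (act_over g _ hx)) _.
  by rewrite lerD ?le_mx_cstar_norm.
- move=> f g hf hg; apply: mx_cstar_norm_le => [|x hx].
    by rewrite mulr_ge0 ?mx_cstar_norm_ge0.
  rewrite mxsmul_colA; apply: le_trans (le_mx_cstar_norm hf (act_over g _ hx)) _.
  by rewrite -mulrA ler_wpM2l ?mx_cstar_norm_ge0 ?le_mx_cstar_norm.
Qed.

(** Test [f] on [c E_jj], and the product on the column [d e_j]: entry [i] of the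
    result is [f_ij c d].  The C*-identity removes [d]. *)
Lemma entry_bound f (P : R) : 0 <= P ->
  (forall g, Mover g -> nu (f ** g) <= P * nu g) ->
  forall i j c, A c -> nA (f i j ** c) <= P * nA c.
Proof.
move=> P0 hP i j c Ac.
apply: (cstar_norm_le_of_right_mul hA) => [||d Ad]; first exact: AM.
  by rewrite mulr_ge0 ?n_ge0.
have hg := diag_unit_over j Ac; have hd := unit_col_over j Ad.
have hfg : Mover (f ** diag_unit j c) by exact: mxsmul_over.
rewrite -smulA -mxsmul_unit_col.
apply: le_trans (entry_le _ (mxsmul_over _ _)) _; first exact/unit_col_over/AM.
have -> : unit_col j (c ** d) = mxsmul (diag_unit j c) (unit_col j d).
  by rewrite diag_unit_col mxE eqxx.
rewrite -mxsmul_colA; apply: le_trans (le_mx_cstar_norm hfg hd) _.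
rewrite module_norm_unit_col // ler_wpM2r ?n_ge0 //.
apply: le_trans (hP _ hg) _.
by rewrite ler_wpM2l // mx_cstar_norm_unit_diag.
Qed.

Lemma matrix_bound f (p : 'I_n -> 'I_n -> R) g :
  (forall i j c, A c -> nA (f i j ** c) <= p i j * nA c) ->
  (forall i j, 0 <= p i j) -> Mover g ->
  nu (f ** g) <= (\sum_i \sum_j p i j) * nu g.
Proof.
move=> hp p0 hg.
have S0 : 0 <= \sum_i \sum_j p i j by do 2 apply: sumr_ge0 => ? _.
apply: mx_cstar_norm_le => [|x hx]; first by rewrite mulr_ge0 ?mx_cstar_norm_ge0.
rewrite mxsmul_colA; apply: le_trans (module_norm_mul_le hp p0 (mxsmul_over _ hx)) _.
by rewrite -mulrA ler_wpM2l ?le_mx_cstar_norm.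
Qed.

Local Notation p := (left_mult_norm A nA).
Local Notation P := (left_mult_norm (V := mxalg B n) Mover nu).

Lemma left_mult_norm_entry_le f i j : algebra_norm setT P -> p (f i j) <= P f.
Proof.
move=> hP; have P0 := left_mult_norm_ge0 mx_left_essential_ideal mx_algebra_norm f.
apply: (left_mult_norm_le hAB nN P0).
apply: entry_bound => // g hg.
exact: (le_left_mult_norm mx_left_essential_ideal mx_algebra_norm).
Qed.

Lemma left_mult_norm_le_sum f : algebra_norm setT p -> P f <= \sum_i \sum_j p (f i j).
Proof.
move=> hp; have p0 := left_mult_norm_ge0 hAB nN.
apply: (left_mult_norm_le mx_left_essential_ideal mx_algebra_norm).
  by do 2 apply: sumr_ge0 => ? _.
by move=> g hg; apply: matrix_bound => // i j c; exact: (le_left_mult_norm hAB nN).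
Qed.

(** The entrywise limit is a limit in norm, since the norm of a matrix is at most
    the sum of the norms of its entries. *)
Lemma banach_matrix : banach_algebra setT p -> banach_algebra setT P.
Proof.
case=> hp cp.
have p0 := left_mult_norm_ge0 hAB nN.
have P0 := left_mult_norm_ge0 mx_left_essential_ideal mx_algebra_norm.
have hP : algebra_norm setT P.
  apply: (left_mult_algebra_norm mx_left_essential_ideal mx_algebra_norm) => f.
  exists (\sum_i \sum_j p (f i j)) => g hg; apply: matrix_bound => // i j c.
  exact: (le_left_mult_norm hAB nN).
split=> // u _ hu.
have /= ex i j : exists v, forall e : R, 0 < e ->
    exists k0, forall k, (k0 <= k)%N -> p (u k i j - v) < e.
  have [||v _ hv] := cp (fun k => u k i j) => //.
    move=> e e0; have [k0 hk] := hu e e0; exists k0 => k l kk kl.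
    apply: le_lt_trans (hk k l kk kl).
    by have := @left_mult_norm_entry_le (u k - u l) i j hP; rewrite !mxE.
  by exists v; apply/cvg0_eps.
pose v : mxalg B n := \matrix_(i, j) sval (cid (ex i j)).
have hv i j : forall e : R, 0 < e ->
    exists k0, forall k, (k0 <= k)%N -> p ((u k - v) i j) < e.
  by move=> e /(svalP (cid (ex i j)))[k0 hk]; exists k0 => k /hk; rewrite !mxE.
exists v => //.
apply: (@squeeze_cvgr _ _ _ _ (fun=> 0) (fun k => \sum_i \sum_j p ((u k - v) i j))).
- by apply: nearW => k; rewrite P0 left_mult_norm_le_sum.
- exact: cvg_cst.
- apply: cvg0_sum => i; apply: cvg0_sum => j.
  by apply/cvg0_eps => [k|]; [exact: p0 | exact: hv].
Qed.

(** [b] is identified with [b E_jj], which has the same norm as [b]: the upper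
    bound is [left_mult_norm_le_sum], where one term of the sum survives. *)
Lemma banach_of_matrix (j0 : 'I_n) :
  banach_algebra setT P -> banach_algebra setT p.
Proof.
case=> hP cP.
have p0 := left_mult_norm_ge0 hAB nN.
have P0 := left_mult_norm_ge0 mx_left_essential_ideal mx_algebra_norm.
have hp : algebra_norm setT p.
  apply: (left_mult_algebra_norm hAB nN) => b.
  exists (P (diag_unit j0 b)) => a Aa.
  have -> : b = diag_unit j0 b j0 j0 by rewrite mxE !eqxx.
  apply: entry_bound => // g hg; rewrite mxE !eqxx.
  exact: (le_left_mult_norm mx_left_essential_ideal mx_algebra_norm).
have P_diag b : P (diag_unit j0 b) <= p b.
  apply: le_trans (left_mult_norm_le_sum _ hp) _.
  have pz : p 0 = 0 by exact: algebra_norm0 hp.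
  rewrite (bigD1 j0) //= (bigD1 j0) //= mxE !eqxx.
  rewrite [X in _ + X + _]big1 ?addr0 => [|j /negPf jj]; last first.
    by rewrite mxE eqxx jj.
  rewrite big1 ?addr0 // => i /negPf ii.
  by apply: big1 => j _; rewrite mxE ii.
split=> // u _ hu.
have diagB b b' : diag_unit j0 b - diag_unit j0 b' = diag_unit j0 (b - b').
  by apply/matrixP => i j; rewrite !mxE; case: (i == j0); case: (j == j0); rewrite ?subr0.
have [||v _ hv] := cP (fun k => diag_unit j0 (u k)).
- by [].
- move=> e e0; have [k0 hk] := hu e e0; exists k0 => k l kk kl.
  by rewrite diagB; apply: le_lt_trans (P_diag _) (hk k l kk kl).
exists (v j0 j0) => //.
apply: squeeze_cvgr (cvg_cst 0) hv; apply: nearW => k; rewrite p0 andTb.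
have := @left_mult_norm_entry_le (diag_unit j0 (u k) - v) j0 j0 hP.
by rewrite !mxE !eqxx.
Qed.

End MatrixAlgebraNorm.
End MatrixNorms.

Theorem theorem5p2 (R : realType) (B : starAlgType R) (nB : B -> R)
    (A : set B) (nA : B -> R)
    (hB : algebra_norm setT nB)
    (hA : cstar_algebra A nA)
    (hAB : left_essential_ideal A) :
  banach_algebra setT (left_mult_norm A nA) <->
  (forall n : nat, (2 <= n)%N ->
     banach_algebra (V := mxalg B n) setT
       (left_mult_norm (V := mxalg B n) (mx_over A (m := n) (n := n))
          (mx_cstar_norm A nA (n := n)))).
Proof.
split=> [hp n _|hP]; first exact: banach_matrix.
exact: (banach_of_matrix hA hAB (ord0 : 'I_2) (hP 2 isT)).
Qed.
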